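(* Let $\alpha_1,\alpha_2,\beta_1,\beta_2>0$, $\nu\in(0,1)$, $\mu\geq0$, let $\tilde X^{\nu,\mu}(t):=X^1(\tilde S^{\nu,\mu}(t))$ be the time-changed process described in the context, and let $\tilde p^{\nu,\mu}_{k,n}(t):=P(\tilde X^{\nu,\mu}(t)=n|\tilde X^{\nu,\mu}(0)=k)$, $k,n\in\mathbb{Z}$, $t\geq0$. Write $\sigma:=\alpha_1+\alpha_2+\beta_1+\beta_2$, $\delta:=\beta_1+\beta_2-\alpha_1-\alpha_2$, $\rho:=\frac{\alpha_1\beta_1}{\alpha_2\beta_2}$, and let $\vartheta^n_{r,s}$, $\eta^n_{r,s}$ and $V_\nu(b;z)$ be as in the context. (i) Assume that $\alpha_1+\alpha_2\neq\beta_1+\beta_2$ and put $z_t:=-t\left(\frac{\sigma}{2}+\mu\right)^\nu$. Then, for all $s,r\in\mathbb{Z}$: $$\tilde p^{\nu,\mu}_{2r,2s}(t)=e^{\mu^\nu t}\sum_{n=|s-r|}^{+\infty}\left(\frac{\delta}{\sigma+2\mu}\right)^{2n}\rho^{s-r}\vartheta^n_{r,s}(\alpha_1,\alpha_2,\beta_1,\beta_2)\left\{\frac{1}{(2n)!}V_\nu(1-2n;z_t)-\frac{\delta}{\sigma+2\mu}\frac{1}{(2n+1)!}V_\nu(-2n;z_t)\right\};$$ $$\begin{aligned}\tilde p^{\nu,\mu}_{2r,2s+1}(t)=\frac{2e^{\mu^\nu t}}{\sigma+2\mu}\Big\{&-\alpha_1\sum_{n=|s-r|}^{+\infty}\left(\frac{\delta}{\sigma+2\mu}\right)^{2n}\rho^{s-r}\vartheta^n_{r,s}(\alpha_1,\alpha_2,\beta_1,\beta_2)\frac{1}{(2n+1)!}V_\nu(-2n;z_t)\\&-\alpha_2\sum_{n=|s-r+1|}^{+\infty}\left(\frac{\delta}{\sigma+2\mu}\right)^{2n}\rho^{s-r+1}\vartheta^n_{r,s+1}(\alpha_1,\alpha_2,\beta_1,\beta_2)\frac{1}{(2n+1)!}V_\nu(-2n;z_t)\Big\};\end{aligned}$$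 $$\begin{aligned}\tilde p^{\nu,\mu}_{2r+1,2s}(t)=\frac{2e^{\mu^\nu t}}{\sigma+2\mu}\Big\{&-\beta_2\sum_{n=|s-r|}^{+\infty}\left(\frac{-\delta}{\sigma+2\mu}\right)^{2n}\rho^{s-r}\vartheta^n_{r,s}(\beta_1,\beta_2,\alpha_1,\alpha_2)\frac{1}{(2n+1)!}V_\nu(-2n;z_t)\\&-\beta_1\sum_{n=|s-r-1|}^{+\infty}\left(\frac{-\delta}{\sigma+2\mu}\right)^{2n}\rho^{s-r-1}\vartheta^n_{r,s-1}(\beta_1,\beta_2,\alpha_1,\alpha_2)\frac{1}{(2n+1)!}V_\nu(-2n;z_t)\Big\};\end{aligned}$$ $$\tilde p^{\nu,\mu}_{2r+1,2s+1}(t)=e^{\mu^\nu t}\sum_{n=|s-r|}^{+\infty}\left(\frac{-\delta}{\sigma+2\mu}\right)^{2n}\rho^{s-r}\vartheta^n_{r,s}(\beta_1,\beta_2,\alpha_1,\alpha_2)\left\{\frac{1}{(2n)!}V_\nu(1-2n;z_t)-\frac{-\delta}{\sigma+2\mu}\frac{1}{(2n+1)!}V_\nu(-2n;z_t)\right\}.$$ (ii) Assume that $\alpha_1+\alpha_2=\beta_1+\beta_2$ and put $w_t:=-t(\alpha_1+\alpha_2+\mu)^\nu$. Then, for all $s,r\in\mathbb{Z}$: $$\tilde p^{\nu,\mu}_{2r,2s}(t)=e^{\mu^\nu t}\sum_{n=|s-r|}^{+\infty}\left(\frac{1}{\alpha_1+\alpha_2+\mu}\right)^{2n}\rho^{s-r}\eta^n_{r,s}(\alpha_1,\alpha_2,\beta_1,\beta_2)\frac{1}{(2n)!}V_\nu(1-2n;w_t);$$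 $$\begin{aligned}\tilde p^{\nu,\mu}_{2r,2s+1}(t)=e^{\mu^\nu t}\Big\{&-\alpha_1\sum_{n=|s-r|}^{+\infty}\left(\frac{1}{\alpha_1+\alpha_2+\mu}\right)^{2n+1}\rho^{s-r}\eta^n_{r,s}(\alpha_1,\alpha_2,\beta_1,\beta_2)\frac{1}{(2n+1)!}V_\nu(-2n;w_t)\\&-\alpha_2\sum_{n=|s-r+1|}^{+\infty}\left(\frac{1}{\alpha_1+\alpha_2+\mu}\right)^{2n+1}\rho^{s-r+1}\eta^n_{r,s+1}(\alpha_1,\alpha_2,\beta_1,\beta_2)\frac{1}{(2n+1)!}V_\nu(-2n;w_t)\Big\};\end{aligned}$$ $$\begin{aligned}\tilde p^{\nu,\mu}_{2r+1,2s}(t)=e^{\mu^\nu t}\Big\{&-\beta_2\sum_{n=|s-r|}^{+\infty}\left(\frac{1}{\alpha_1+\alpha_2+\mu}\right)^{2n+1}\rho^{s-r}\eta^n_{r,s}(\beta_1,\beta_2,\alpha_1,\alpha_2)\frac{1}{(2n+1)!}V_\nu(-2n;w_t)\\&-\beta_1\sum_{n=|s-r-1|}^{+\infty}\left(\frac{1}{\alpha_1+\alpha_2+\mu}\right)^{2n+1}\rho^{s-r-1}\eta^n_{r,s-1}(\beta_1,\beta_2,\alpha_1,\alpha_2)\frac{1}{(2n+1)!}V_\nu(-2n;w_t)\Big\};\end{aligned}$$ $$\tilde p^{\nu,\mu}_{2r+1,2s+1}(t)=e^{\mu^\nu t}\sum_{n=|s-r|}^{+\infty}\left(\frac{1}{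\alpha_1+\alpha_2+\mu}\right)^{2n}\rho^{s-r}\eta^n_{r,s}(\beta_1,\beta_2,\alpha_1,\alpha_2)\frac{1}{(2n)!}V_\nu(1-2n;w_t).$$
   Context: $\{X^1(t):t\geq 0\}$ is the continuous-time Markov chain on $\mathbb{Z}$ whose state probabilities $p_{k,n}(t):=P(X^1(t)=n|X^1(0)=k)$ satisfy $p_{k,n}(0)=1_{\{k=n\}}$ and whose generator $g_{k,n}:=\lim_{t\to 0}\frac{p_{k,n}(t)-p_{k,n}(0)}{t}$ is as follows. For even $k$: $g_{k,k+1}=\alpha_1$, $g_{k,k-1}=\alpha_2$, $g_{k,k}=-(\alpha_1+\alpha_2)$. For odd $k$: $g_{k,k+1}=\beta_1$, $g_{k,k-1}=\beta_2$, $g_{k,k}=-(\beta_1+\beta_2)$. All other entries are $0$. $\{S^\nu(t):t\geq0\}$ is the $\nu$-stable subordinator: $\mathbb{E}[e^{\gamma S^\nu(t)}]=e^{-|\gamma|^\nu t}$ if $\gamma\leq0$ and $=\infty$ otherwise; $f_{S^\nu(t)}$ denotes the density of $S^\nu(t)$, $t>0$. $\{\tilde S^{\nu,\mu}(t):t\geq0\}$ is the (possibly tempered) stable subordinator, i.e. the subordinator with $\tilde S^{\nu,\mu}(0)=0$ and, for $t>0$, $P(\tilde S^{\nu,\mu}(t)\in dx)=e^{-\mu x+\mu^\nu t}f_{S^\nu(t)}(x)\,dx$ (for $\mu=0$ it is $S^\nu$). $\tilde S^{\nu,\mu}$ is independent of $X^1$. Generalized Fox-Wright function: ${}_p\psi_q\left[\begin{smallmatrix}(a_l,A_l)_{1,p}\\(b_l,B_l)_{1,q}\end{smallmatrix};z\right]=\sum_{n=0}^{+\infty}\frac{z^n}{n!}\frac{\prod_{j=1}^p\Gamma(a_j+A_jn)}{\prod_{l=1}^q\Gamma(b_l+B_ln)}$,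 with $z,a_j,b_l\in\mathbb{C}$, $A_j,B_l\in\mathbb{R}$ (and $1/\Gamma(x)=0$ at $x=0,-1,-2,\ldots$). We abbreviate $$V_\nu(b;z):={}_1\psi_1\left[\begin{smallmatrix}(1,\nu)\\(b,\nu)\end{smallmatrix};z\right]=\sum_{j=0}^{+\infty}\frac{z^j}{j!}\frac{\Gamma(1+\nu j)}{\Gamma(b+\nu j)}.$$ Binomial coefficients with negative arguments are equal to zero (and $\binom{m}{l}=0$ for $l>m\geq0$, as usual). If $\alpha_1+\alpha_2\neq\beta_1+\beta_2$, $$\vartheta^n_{r,s}(\alpha_1,\alpha_2,\beta_1,\beta_2):=\left(\frac{4\alpha_2\beta_2}{(\alpha_1+\alpha_2-\beta_1-\beta_2)^2}\right)^{s-r}\sum_{h=0}^{n-s+r}\binom{n}{h+s-r}\left(\frac{4\alpha_1\beta_2}{(\alpha_1+\alpha_2-\beta_1-\beta_2)^2}\right)^{h}\sum_{l=0}^{h}\binom{h+s-r}{l}\binom{h+s-r}{h-l}\left(\frac{\alpha_2\beta_1}{\alpha_1\beta_2}\right)^{l};$$ if $\alpha_1+\alpha_2=\beta_1+\beta_2$, $$\eta^n_{r,s}(\alpha_1,\alpha_2,\beta_1,\beta_2):=\left(\frac{\alpha_2}{\alpha_1}\right)^{s-r}(\alpha_1\beta_2)^n\sum_{l=0}^{n-s+r}\binom{n}{l}\binom{n}{s-r+l}\left(\frac{\alpha_2\beta_1}{\alpha_1\beta_2}\right)^{l}.$$ $\vartheta^n_{r,s}(\beta_1,\beta_2,\alpha_1,\alpha_2)$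 and $\eta^n_{r,s}(\beta_1,\beta_2,\alpha_1,\alpha_2)$ are obtained by exchanging $\alpha_i\leftrightarrow\beta_i$, $i=1,2$. *)

(* Defs.v *)
From HB Require Import structures.
From mathcomp Require Import all_boot all_order all_algebra.
From mathcomp Require Import all_classical all_reals all_analysis.

Set Implicit Arguments.
Unset Strict Implicit.
Unset Printing Implicit Defensive.

Import Order.TTheory GRing.Theory Num.Theory.
Import numFieldNormedType.Exports.

Local Open Scope classical_set_scope.
Local Open Scope ring_scope.

(* The state space of the chain: the integers with all subsets measurable. *)
HB.instance Definition _ := isPointed.Build int 0.
HB.instance Definition _ := @isMeasurable.Build default_measure_display
  int (@discrete_measurable int) (@discrete_measurable0 int)
  (@discrete_measurableC int) (@discrete_measurableU int).

(* Processes are indexed by all of R; only the times t >= 0 are constrained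
   or used. *)
Section Processes.
Context {R : realType} {d : measure_display} {T : measurableType d}.
Implicit Type P : probability T R.

(* P (A | B), meaningful when P B is nonzero. *)
Definition cond_prob P (A B : set T) : R := fine (P (A `&` B)) / fine (P B).

Definition process_sigma {d'} {E : measurableType d'} (Y : R -> T -> E) :
    set (set T) :=
  <<s [set A | exists t B, [/\ 0 <= t, measurable B & A = Y t @^-1` B]] >>.

Definition independent_processes {d1 d2} {E1 : measurableType d1}
    {E2 : measurableType d2} P (Y : R -> T -> E1) (Z : R -> T -> E2) :=
  forall A B, process_sigma Y A -> process_sigma Z B ->
    P (A `&` B) = (P A * P B)%E.

(* Honest (stochastic) transition functions on int; p t k n is the
   probability of moving from k to n in time t. *)
Record transition_function (p : R -> int -> int -> R) : Prop := {
  tf_ge0 : forall (t : R) k n, 0 <= t -> 0 <= p t k n ;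
  tf_sum : forall (t : R) k, 0 <= t ->
    (\esum_(n in [set: int]) (p t k n)%:E = 1)%E ;
  tf_chapman_kolmogorov : forall (u t : R) k n, 0 <= u -> 0 <= t ->
    (\esum_(j in [set: int]) (p u k j * p t j n)%:E = (p (u + t)%R k n)%:E)%E ;
  tf_0 : forall k n, p 0 k n = (k == n)%:R }.

Definition has_generator (p : R -> int -> int -> R) (g : int -> int -> R) :=
  forall k n, (fun t => (p t k n - p 0 k n) / t) @ 0^'+ --> g k n.

(* Time-homogeneous Markov chain with transition function p, and with
   right-continuous paths (for the discrete topology of int).  The initial law
   is arbitrary.  With m = 0 and t 0 = 0, the Markov property gives
   p t k n = P (X t = n | X 0 = k) whenever P (X 0 = k) is nonzero. *)
Record markov_chain P (p : R -> int -> int -> R) (X : R -> T -> int) : Prop := {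
  mc_transition : transition_function p ;
  mc_measurable : forall t : R, 0 <= t -> measurable_fun [set: T] (X t) ;
  mc_right_continuous : forall w (t : R), 0 <= t ->
    \forall u \near t^'+, X u w = X t w ;
  mc_markov : forall (m : nat) (t : nat -> R) (i : nat -> int),
    0 <= t 0%N -> (forall j, t j <= t j.+1) ->
    P (\bigcap_(j < m.+2) (X (t j) @^-1` [set i j])) =
    (P (\bigcap_(j < m.+1) (X (t j) @^-1` [set i j]))
     * (p (t m.+1 - t m) (i m) (i m.+1))%:E)%E }.

(* Nondecreasing Levy process started at 0. *)
Record subordinator P (S : R -> T -> R) : Prop := {
  sub_measurable : forall t : R, 0 <= t -> measurable_fun [set: T] (S t) ;
  sub_0 : forall w, S 0 w = 0 ;
  sub_nondecreasing : forall w (u t : R), 0 <= u -> u <= t -> S u w <= S t w ;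
  sub_right_continuous : forall w (t : R), 0 <= t ->
    (fun u => S u w) @ t^'+ --> S t w ;
  sub_stationary : forall (u t : R) (B : set R), 0 <= u -> 0 <= t -> measurable B ->
    P ((fun w => S (u + t) w - S u w) @^-1` B) = P (S t @^-1` B) ;
  sub_independent : forall (m : nat) (t : nat -> R) (B : nat -> set R),
    0 <= t 0%N -> (forall j, t j <= t j.+1) -> (forall j, measurable (B j)) ->
    P (\bigcap_(j < m) ((fun w => S (t j.+1) w - S (t j) w) @^-1` B j)) =
    (\prod_(j < m) P ((fun w => S (t j.+1) w - S (t j) w)%R @^-1` B j))%E }.

(* The exponential moments of positive order are infinite at positive times
   only, since S 0 = 0. *)
Record stable_subordinator P (nu : R) (S : R -> T -> R) : Prop := {
  stable_sub : subordinator P S ;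
  stable_laplace : forall g t : R, g <= 0 -> 0 <= t ->
    ('E_P[fun w => expR (g * S t w)%R] = (expR (- (`|g| `^ nu) * t))%:E)%E ;
  stable_infinite : forall g t : R, 0 < g -> 0 < t ->
    ('E_P[fun w => expR (g * S t w)%R] = +oo)%E }.

Definition has_density P (Y : T -> R) (f : R -> R) : Prop :=
  [/\ measurable_fun [set: R] f, (forall x, 0 <= f x) &
      forall B, measurable B ->
        P (Y @^-1` B) = (\int[lebesgue_measure]_(x in B) (f x)%:E)%E].

(* f t is the density at time t > 0 of the nu-stable subordinator; for mu = 0,
   mu `^ nu = 0 and S is itself nu-stable. *)
Definition tempered_stable_subordinator P (nu mu : R) (f : R -> R -> R)
    (S : R -> T -> R) : Prop :=
  subordinator P S /\
  forall t : R, 0 < t ->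
    has_density P (S t) (fun x => expR (- mu * x + mu `^ nu * t) * f t x).

Definition time_change (X : R -> T -> int) (S : R -> T -> R) : R -> T -> int :=
  fun t w => X (S t w) w.

End Processes.

Section Formulas.
Context {R : realType}.

Definition chain_gen (a1 a2 b1 b2 : R) (k n : int) : R :=
  let up := if (2 %| k)%Z then a1 else b1 in
  let down := if (2 %| k)%Z then a2 else b2 in
  if n == k + 1 then up
  else if n == k - 1 then down
  else if n == k then - (up + down)
  else 0.

Definition euler_gamma (x : R) : R :=
  \int[lebesgue_measure]_(u in `]0, +oo[) (u `^ (x - 1) * expR (- u)).

Definition gamma_shift (x : R) : nat :=
  if 0 < x then 0%N else (Num.truncn (- x)).+1.

(* Euler's integral for x > 0, extended by
   Gamma x = Gamma (x + m) / (x (x + 1) ... (x + m - 1)), with m the least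
   natural number such that x + m > 0.  At x = 0, -1, -2, ... the denominator
   is 0, so Gamma x = 0 and hence (Gamma x)^-1 = 0, which is the convention for
   the reciprocal of Gamma at its poles. *)
Definition Gamma (x : R) : R :=
  let m := gamma_shift x in
  euler_gamma (x + m%:R) / \prod_(i < m) (x + i%:R).

Definition fox_wright_term (a b : seq (R * R)) (z : R) (n : nat) : R :=
  z ^+ n / n`!%:R *
  ((\prod_(c <- a) Gamma (c.1 + c.2 * n%:R))
   * \prod_(c <- b) (Gamma (c.1 + c.2 * n%:R))^-1).

Definition fox_wright (a b : seq (R * R)) (z : R) : R :=
  limn (series (fox_wright_term a b z)).

Definition wright_V (nu b z : R) : R := fox_wright [:: (1, nu)] [:: (b, nu)] z.

Definition binz (m l : int) : R :=
  if (0 <= m) && (0 <= l) then 'C(`|m|%N, `|l|%N)%:R else 0.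

(* Number of terms of a sum indexed by 0, ..., m. *)
Definition nterms (m : int) : nat := if 0 <= m then `|m|%N.+1 else 0%N.

Definition theta_coef (a1 a2 b1 b2 : R) (r s : int) (n : nat) : R :=
  let D := (a1 + a2 - b1 - b2) ^+ 2 in
  (4 * a2 * b2 / D) ^ (s - r) *
  \sum_(h < nterms (n%:Z - s + r))
    (binz n%:Z (h%:Z + s - r) * (4 * a1 * b2 / D) ^+ h *
     \sum_(l < h.+1)
       (binz (h%:Z + s - r) l%:Z * binz (h%:Z + s - r) (h%:Z - l%:Z)
        * (a2 * b1 / (a1 * b2)) ^+ l)).

Definition eta_coef (a1 a2 b1 b2 : R) (r s : int) (n : nat) : R :=
  (a2 / a1) ^ (s - r) * (a1 * b2) ^+ n *
  \sum_(l < nterms (n%:Z - s + r))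
    (binz n%:Z l%:Z * binz n%:Z (s - r + l%:Z)
     * (a2 * b1 / (a1 * b2)) ^+ l).

Definition sums_from (m : nat) (u : nat -> R) (l : R) : Prop :=
  (fun N => \sum_(m <= n < N) u n) @ \oo --> l.

End Formulas.

(* Main.v *)
Require Import Defs.
From HB Require Import structures.
From mathcomp Require Import all_boot all_order all_algebra.
From mathcomp Require Import all_classical all_reals all_analysis.
From mathcomp Require Import measurable_realfun ring lra zify.

Set Implicit Arguments.
Unset Strict Implicit.
Unset Printing Implicit Defensive.

Import Order.TTheory GRing.Theory Num.Theory.
Import numFieldNormedType.Exports.

Local Open Scope classical_set_scope.
Local Open Scope ring_scope.

(** The generator G of the chain, shifted by half the total rate sigma, squares
    to a walk that moves by whole cells {2r, 2r + 1}: (G + sigma/2)^2 has the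
    same translation-invariant action on even and on odd sites, with symbol
    delta^2/4 + (a1 + a2/u)(b2 + b1 u).  The coefficients of the powers of this
    symbol are rho^(s-r) theta (up to (delta/2)^(2n)) or rho^(s-r) eta, so that
    exp (sigma x / 2) p x k n = sum_i x^i / i! ((G + sigma/2)^i)_(k,n) is an
    explicit power series in x.

    Conditioning on the independent clock turns the law of the time-changed
    process into the mean of p x k n at x = S t, and the tempering density
    exp (- mu x + mu^nu t) changes the factor exp (- sigma x / 2) into
    exp (- lambda x), lambda = sigma/2 + mu.  It remains to integrate the
    series termwise, which is legitimate because sum_i |coefficient_i| x^i / i!
    is at most 2 exp (sigma x / 2), and to recognise the moments
    E [S^m exp (- lambda S)]: they are, up to sign, the derivatives of
    exp (- t lambda^nu), whose expansion in powers of lambda^nu is the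
    Fox-Wright function V_nu (1 - m; .). *)

(** * Euler's Gamma function *)

(** The shift by [sigma / 2] is the one that makes the diagonal entries opposite: [delta / 2] on
    even sites, [- delta / 2] on odd ones. In the square, a diagonal step followed by a jump is
    cancelled by the same jump followed by a diagonal step, so even powers link only sites of equal
    parity, and one extra factor supplies the odd powers. The squared walk has total weight
    [(sigma / 2)^2], whence the growth bound on the coefficients. For mu = 0 the factors
    [exp (sigma x / 2)] and [exp (- lambda x)] compensate exactly, so the termwise integration rests
    on bounded convergence.

    The generator gives only entrywise derivatives of p at time 0. Differentiability at every t > 0
    has to be derived, and there honesty of p together with vanishing row sums of the generator
    controls the infinitely many remote states. Chain and clock are tied only through events at
    fixed times, hence an approximation of the clock by grid values. The off-diagonal formulas
    contain two sums each, whose separate convergence does not follow from that of their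
    combination. *)

Section EulerGamma.
Context {R : realType}.
Implicit Types x y u : R.
Local Notation mu := (@lebesgue_measure R).

Lemma expR_ge_Xn n x : 0 <= x -> x ^+ n / n`!%:R <= expR x.
Proof.
move=> x0; case: n => [|n].
  by rewrite expr0 fact0 divr1 -expR0 ler_expR.
by apply: le_trans (expR_ge1Dxn n x0); rewrite lerDr.
Qed.

Lemma powR_le_Xn n x y : 1 <= x -> y <= n%:R -> x `^ y <= x ^+ n.
Proof.
move=> x1 yn; rewrite -powR_mulrn ?(le_trans _ x1)//.
by rewrite ler_powR.
Qed.

Definition gamma_integrand x u := u `^ (x - 1) * expR (- u).

Lemma gamma_integrand_ge0 x u : 0 <= gamma_integrand x u.
Proof. by rewrite mulr_ge0 ?powR_ge0 ?expR_ge0. Qed.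

Lemma measurable_gamma_integrand x (D : set R) : measurable_fun D (gamma_integrand x).
Proof.
apply: measurable_funTS; apply: measurable_funM; first exact: measurable_powR.
by apply: measurableT_comp => //; exact: measurable_funN.
Qed.

(** Kept in the extended reals because the recurrence is established before finiteness, and then
    yields finiteness for small x. *)
Definition gamma_int x : \bar R :=
  (\int[mu]_(u in `]0%R, +oo[) (gamma_integrand x u)%:E)%E.

Lemma gamma_int_ge0 x : (0 <= gamma_int x)%E.
Proof. by apply: integral_ge0 => u _; rewrite lee_fin gamma_integrand_ge0. Qed.

Lemma euler_gammaE x : euler_gamma x = fine (gamma_int x).
Proof. by []. Qed.

(** The intervals [[a n, b n]] exhaust the open half-line and avoid 0, where powers may fail to be
    differentiable; the offset 2 gives [a n < 1 < b n]. *)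
Let a n : R := n.+2%:R^-1.
Let b n : R := n.+2%:R.

Let a_gt0 n : 0 < a n. Proof. by rewrite invr_gt0. Qed.
Let ab n : a n < b n.
Proof.
by rewrite (@lt_trans _ _ 1)// ?invf_lt1// /b ltr1n.
Qed.

Lemma cvg_gamma_int x :
  (\int[mu]_(u in `[a n, b n]) (gamma_integrand x u)%:E @[n --> \oo] --> gamma_int x)%E.
Proof.
rewrite /gamma_int.
have -> : `]0%R, +oo[%classic = \bigcup_n `[a n, b n]%classic.
  apply/seteqP; split => [u /=|u [n _] /=]; rewrite !in_itv/= ?andbT.
    move=> u0; pose n := (Num.truncn (Num.max u u^-1)); exists n => //=.
    have := truncnS_gt (Num.max u u^-1); rewrite -/n gt_max => /andP[un uVn].
    rewrite in_itv/= /a /b; apply/andP; split.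
      rewrite -[u]invrK lef_pV2 ?posrE ?invr_gt0//.
      by rewrite (le_trans (ltW uVn))// ler_nat.
    by rewrite (le_trans (ltW un))// ler_nat.
  by case/andP => au _; exact: lt_le_trans au.
apply: ge0_nondecreasing_set_cvg_integral => //.
- move=> n m nm; rewrite subsetEset; apply: subset_itv; rewrite bnd_simp /a /b.
    by rewrite lef_pV2 ?posrE// ler_nat.
  by rewrite ler_nat.
- by move=> i; apply/measurable_EFinP; exact: measurable_gamma_integrand.
- by move=> i u _; rewrite lee_fin gamma_integrand_ge0.
Qed.

Lemma cvg_powR_expRN x : b n `^ x * expR (- b n) @[n --> \oo] --> 0.
Proof.
pose N := (Num.truncn `|x|).+1.
have xN : x <= N%:R.
  by apply: le_trans (ler_norm x) _; exact/ltW/truncnS_gt.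
(* From [b ^ x <= b ^ N] and [b ^ (N + 1) / (N + 1)! <= exp b]; one power more than N leaves the
   factor [1 / b n = a n]. *)
apply: (@squeeze_cvgr _ _ _ _ (cst 0) (fun n => N.+1`!%:R * a n)).
- near=> n; rewrite mulr_ge0 ?powR_ge0 ?expR_ge0//=.
  have b1 : 1 <= b n by rewrite ler1n.
  have b0 : 0 < b n by rewrite (lt_le_trans _ b1).
  rewrite expRN ler_pdivrMr ?expR_gt0// (le_trans (powR_le_Xn b1 xN))//.
  have := @expR_ge_Xn N.+1 _ (ltW b0).
  rewrite ler_pdivrMr ?ltr0n ?fact_gt0// => h.
  by rewrite mulrAC ler_pdivlMr// mulrC -exprS mulrC.
- exact: cvg_cst.
- rewrite -[X in _ --> X](mulr0 N.+1`!%:R); apply: cvgM; first exact: cvg_cst.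
  by have := @cvg_harmonic R; rewrite -(cvg_shiftS (@harmonic R)).
Unshelve. all: by end_near. Qed.


Lemma powR_derivable_LR x (c d : R) : 0 < c -> c < d ->
  derivable_oo_LRcontinuous (fun u : R => u `^ x) c d.
Proof.
move=> c0 cd.
have dX y : 0 < y -> derivable (fun u : R => u `^ x) y 1.
  by move=> y0; apply: derivable_powR; rewrite in_itv/= y0.
have cX y : 0 < y -> {for y, continuous (fun u : R => u `^ x)}.
  move=> y0; apply: differentiable_continuous.
  by apply/derivable1_diffP; exact: dX.
split.
- by move=> y; rewrite in_itv/= => /andP[cy _]; apply: dX; exact: lt_trans cy.
- by apply: cvg_at_right_filter; exact: cX.
- by apply: cvg_at_left_filter; apply: cX; exact: lt_trans cd.
Qed.

Lemma derivable_NexpRN y : is_derive y 1 (fun u : R => - expR (- u)) (expR (- y)).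
Proof.
have : is_derive y 1 (fun u : R => - expR (- u)) (- (expR (- y) * -1)).
  by apply: is_deriveN; apply: is_derive1_comp.
by rewrite mulrN1 opprK.
Qed.

Lemma NexpRN_derivable_LR (c d : R) :
  derivable_oo_LRcontinuous (fun u : R => - expR (- u)) c d.
Proof.
have cX y : {for y, continuous (fun u : R => - expR (- u))}.
  apply: differentiable_continuous.
  by apply/derivable1_diffP; apply: ex_derive; exact: derivable_NexpRN.
split.
- by move=> y _; apply: ex_derive; exact: derivable_NexpRN.
- by apply: cvg_at_right_filter; exact: cX.
- by apply: cvg_at_left_filter; exact: cX.
Qed.

(** Integration by parts with primitive [- expR (- u)]. The boundary terms vanish as n grows: at
    [a n] because x > 0, at [b n] by exponential decay. *)
Lemma gamma_int_recr_itv x n : 0 < x ->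
  (\int[mu]_(u in `[a n, b n]) (gamma_integrand (x + 1) u)%:E =
   (a n `^ x * expR (- a n) - b n `^ x * expR (- b n))%:E +
   x%:E * \int[mu]_(u in `[a n, b n]) (gamma_integrand x u)%:E)%E.
Proof.
move=> x0; rewrite -ge0_integralZl//=; last 3 first.
- by apply/measurable_EFinP; exact: measurable_gamma_integrand.
- by move=> u _; rewrite lee_fin gamma_integrand_ge0.
- by rewrite lee_fin ltW.
have Xpos y : y \in `](a n), (b n)[ -> 0 < y.
  by rewrite in_itv/= => /andP[+ _]; exact: lt_trans.
rewrite /gamma_integrand addrK.
rewrite (@integration_by_parts R (fun u => u `^ x) (fun u => - expR (- u))
  (fun u => x * u `^ (x - 1)) (fun u => expR (- u)))//.
- rewrite [X in (_ - X)%E](_ : _ =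
    (\int[mu]_(y in `[a n, b n]) - (x%:E * (y `^ (x - 1) * expR (- y))%:E))%E); last first.
    by apply: eq_integral => u _; rewrite -EFinM -EFinN; congr (_%:E); ring.
  rewrite integral_ge0N; last first.
    by move=> u _; rewrite -EFinM lee_fin mulr_ge0 ?(ltW x0)// gamma_integrand_ge0.
  by rewrite oppeK; congr (_ + _)%E; congr (_%:E); ring.
- apply: derivable_within_continuous => y yab.
  apply: derivableM => //; apply: derivable_powR; rewrite in_itv/= andbT.
  by move: yab; rewrite in_itv/= => /andP[+ _]; exact: lt_le_trans.
- exact: powR_derivable_LR.
- move=> y /Xpos y0; rewrite powR_derive1// in_itv/= andbT//.
- apply: continuous_subspaceT => y; apply: continuous_comp.
    by apply: (@continuousN _ R^o).
  exact: continuous_expR.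
- exact: NexpRN_derivable_LR.
- by move=> y _; rewrite derive1E; apply: derive_val; exact: derivable_NexpRN.
Qed.

Lemma gamma_int_recr x : 0 < x -> (gamma_int (x + 1) = x%:E * gamma_int x)%E.
Proof.
move=> x0; have /cvg_lim <- // := @cvg_gamma_int (x + 1).
apply/cvg_lim => //; under eq_fun do rewrite gamma_int_recr_itv//.
rewrite -(add0e (x%:E * gamma_int x)%E); apply: cvgeD.
- by rewrite fin_num_adde_defr.
- apply: cvg_EFin; first by near=> n.
  rewrite -(subr0 0); apply: cvgB; last exact: cvg_powR_expRN.
  apply: (@squeeze_cvgr _ _ _ _ (cst 0) (fun n => a n `^ x)).
  + near=> n; rewrite mulr_ge0 ?powR_ge0 ?expR_ge0//=.
    by rewrite ler_piMr ?powR_ge0// expR_le1 oppr_le0 ltW.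
  + exact: cvg_cst.
  + have /cvg_at_rightP := powR_cvg0 x0; apply; split; first exact: a_gt0.
    by have := @cvg_harmonic R; rewrite -(cvg_shiftS (@harmonic R)).
- by apply: cvgeZl => //; exact: cvg_gamma_int.
Unshelve. all: by end_near. Qed.

Lemma gamma_int_lty_ge1 x : 1 <= x -> (gamma_int x < +oo)%E.
Proof.
move=> x1; pose N := (Num.truncn `|x|).+1.
have xN : x - 1 <= N%:R.
  rewrite (@le_trans _ _ x)// ?gerBl//.
  by apply: le_trans (ler_norm x) _; exact/ltW/truncnS_gt.
(* The summand 1 serves u < 1, where [u ^ (x - 1) <= 1]; the other comes from
   [(u / 2) ^ N / N! <= exp (u / 2)]. Half of the decay [exp (- u)] remains, which is the
   exponential density of rate 1/2 up to the factor 2. *)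
pose K : R := 1 + N`!%:R * 2 ^+ N.
have K0 : 0 <= K by rewrite addr_ge0// mulr_ge0// exprn_ge0.
have half0 : 0 < 2^-1 :> R by rewrite invr_gt0.
apply: (@le_lt_trans _ _ (\int[mu]_u ((K * 2)%:E * (exponential_pdf 2^-1 u)%:E))%E); last first.
  rewrite ge0_integralZl//=.
  - by rewrite integral_exponential_pdf// mule1 ltry.
  - by apply/measurable_EFinP; exact: measurable_exponential_pdf.
  - by move=> u _; rewrite lee_fin exponential_pdf_ge0// ltW.
  - by rewrite lee_fin mulr_ge0.
rewrite /gamma_int integral_mkcond; apply: ge0_le_integral => //=.
- by move=> u _; rewrite patchE; case: ifP => // _; rewrite lee_fin gamma_integrand_ge0.
- apply/(measurable_restrictT _ _).1 => //; apply/measurable_EFinP; exact: measurable_gamma_integrand.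
- apply: emeasurable_funM; first exact: measurable_cst.
  by apply/measurable_EFinP; exact: measurable_exponential_pdf.
move=> u _; rewrite patchE; case: ifPn => [|_]; last first.
  by rewrite lee_fin mulr_ge0 ?mulr_ge0// exponential_pdf_ge0// ltW.
rewrite inE/= in_itv/= andbT => u0; rewrite lee_fin exponential_pdfE ?(ltW u0)//.
rewrite [K * 2 * _]mulrA mulfK ?pnatr_eq0// /gamma_integrand.
have -> : expR (- u) = expR (- (2^-1) * u) * expR (- (2^-1) * u).
  by rewrite -expRD; congr expR; field.
rewrite mulrA ler_wpM2r ?expR_ge0// mulNr expRN ler_pdivrMr ?expR_gt0//.
have e1 : 1 <= expR (2^-1 * u) by rewrite -expR0 ler_expR mulr_ge0 ?ltW.
have [u1|u1] := leP 1 u.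
  apply: le_trans (powR_le_Xn u1 xN) _.
  have /(@expR_ge_Xn N) : 0 <= 2^-1 * u by rewrite mulr_ge0 ?ltW.
  rewrite exprMn exprVn ler_pdivrMr ?ltr0n ?fact_gt0// mulrC ler_pdivrMr ?exprn_gt0// => /le_trans; apply.
  rewrite /K mulrDl mul1r -mulrA mulrC -mulrA lerDr.
  by rewrite expR_ge0.
rewrite (@le_trans _ _ 1)//.
  apply: (@le_trans _ _ (u `^ 0)); last by rewrite powRr0.
  by apply: ger_powR; rewrite ?u0 ?(ltW u1)// subr_ge0.
rewrite -[leLHS]mulr1; apply: ler_pM => //.
by rewrite /K lerDl mulr_ge0// exprn_ge0.
Qed.

(** An infinite value at x would propagate through the recurrence to [x + 1 >= 1], where the
    integral is finite. *)
Lemma gamma_int_lty x : 0 < x -> (gamma_int x < +oo)%E.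
Proof.
move=> x0; rewrite ltey; apply/eqP => Ix.
have := @gamma_int_lty_ge1 (x + 1); rewrite lerDr (ltW x0) => /(_ isT).
by rewrite gamma_int_recr// Ix gt0_muley// lte_fin.
Qed.

Lemma euler_gamma_recr x : 0 < x -> euler_gamma (x + 1) = x * euler_gamma x.
Proof.
move=> x0; rewrite !euler_gammaE gamma_int_recr// fineM//.
by rewrite ge0_fin_numE ?gamma_int_ge0// gamma_int_lty.
Qed.

(** A zero integral would make the positive integrand vanish almost everywhere, in particular on
    []0, 1[], which has measure 1. *)
Lemma euler_gamma_gt0 x : 0 < x -> 0 < euler_gamma x.
Proof.
move=> x0; rewrite euler_gammaE fine_gt0// gamma_int_lty// andbT.
rewrite lt_neqAle gamma_int_ge0 andbT eq_sym; apply/eqP => I0.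
have : (\int[mu]_(u in `]0%R, +oo[) `|(gamma_integrand x u)%:E| = 0)%E.
  by under eq_integral do rewrite gee0_abs ?lee_fin ?gamma_integrand_ge0//.
move/ae_eq_integral_abs => /(_ _ _)[||N []] //.
  by apply/measurable_EFinP; exact: measurable_gamma_integrand.
move=> mN N0 subN.
have : (mu `]0%R, 1%R[ <= mu N)%E.
  apply: le_measure; rewrite ?inE// => u /=; rewrite in_itv/= => /andP[u0 _].
  apply: subN => /=; rewrite in_itv/= u0 => /(_ isT) [].
  by apply/eqP; rewrite gt_eqF// mulr_gt0 ?powR_gt0 ?expR_gt0.
by rewrite N0 lebesgue_measure_itv/= lte_fin ltr01 sube0 lee_fin ler10.
Qed.

Lemma euler_gamma_ffact x m : 0 < x ->
  euler_gamma (x + m%:R) = euler_gamma x * \prod_(i < m) (x + i%:R).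
Proof.
move=> x0; elim: m => [|m IH]; first by rewrite big_ord0 addr0 mulr1.
rewrite -natr1 addrA euler_gamma_recr ?ltr_wpDr// IH big_ord_recr/=.
by rewrite mulrC mulrA.
Qed.

(* At a pole of Gamma (x - m) both sides vanish: the junk value Gamma = 0
   matches a zero factor on the right. *)
Lemma Gamma_ratio x m : 0 < x ->
  Gamma x * (Gamma (x - m%:R))^-1 = \prod_(i < m) (x - 1 - i%:R).
Proof.
move=> x0.
have -> : \prod_(i < m) (x - 1 - i%:R) = \prod_(i < m) (x - m%:R + i%:R).
  rewrite (reindex_inj rev_ord_inj)/=; apply: eq_bigr => i _.
  by rewrite natrB// -natr1; ring.
have -> : Gamma x = euler_gamma x.
  by rewrite /Gamma /gamma_shift x0 big_ord0 addr0 divr1.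
rewrite /Gamma; set y := x - m%:R; set M := gamma_shift y.
have yM0 : 0 < y + M%:R.
  rewrite /M /gamma_shift; case: (ltP 0 y) => [|y0]; first by rewrite addr0.
  by rewrite addrC -ltrBlDr sub0r; exact: truncnS_gt.
(* Since [y + m = x > 0], the least admissible shift M of y is at most m. The product of m factors
   then splits at M: the first M come from the extension formula at y, the others from the
   recurrence between [y + M] and x. *)
have Mm : (M <= m)%N.
  rewrite /M /gamma_shift; case: (ltP 0 y) => // y0.
  rewrite -(ltr_nat R) (@le_lt_trans _ _ (- y))//.
    by have := @truncn_le R (- y); rewrite oppr_ge0 y0.
  by rewrite /y opprB ltrBlDr ltrDl.
have xE : x = (y + M%:R) + (m - M)%:R by rewrite natrB// /y; ring.
rewrite {1}xE euler_gamma_ffact// invf_div.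
rewrite [LHS]mulrC mulrA divfK ?gt_eqF ?euler_gamma_gt0//.
rewrite -[RHS](big_mkord xpredT (fun i => y + i%:R)) (@big_cat_nat _ _ _ M)//= big_mkord; congr (_ * _).
rewrite -[X in _ = \prod_(X <= _ < _) _]add0n big_addn big_mkord; apply: eq_bigr => i _.
by rewrite natrD addrA addrAC.
Qed.

End EulerGamma.

(** * Entire series and Laplace transforms *)

Section EntireSeries.
Context {R : realType}.
Implicit Types (c : nat -> R) (x y K : R).

(** Infinite radius of convergence, in a form visibly stable under linear combinations,
    multiplication by n and differentiation. *)
Definition entire_coef c :=
  forall K, 0 < K -> exists M, forall n, `|c n| * K ^+ n <= M.

Lemma natr_le_exp2 n : n%:R <= 2 ^+ n :> R.
Proof. by rewrite -natrX ler_nat ltnW// ltn_expl. Qed.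

(** The factor n is absorbed by [n <= 2 ^ n], at the price of using the bound at [2 * K]. *)
Lemma entire_coefM_nat c : entire_coef c -> entire_coef (fun n => n%:R * c n).
Proof.
move=> ec K K0; have [|M HM] := ec (2 * K); first by rewrite mulr_gt0.
exists M => n; apply: le_trans (HM n).
rewrite normrM exprMn normr_nat [n%:R * _]mulrC -mulrA ler_wpM2l//.
by rewrite ler_wpM2r ?(exprn_ge0 _ (ltW K0))// natr_le_exp2.
Qed.

Lemma entire_coefZ c k : entire_coef c -> entire_coef (fun n => k * c n).
Proof.
move=> ec K K0; have [M HM] := ec K K0; exists (`|k| * M) => n.
by rewrite normrM -mulrA ler_wpM2l.
Qed.

Lemma entire_coefD c1 c2 : entire_coef c1 -> entire_coef c2 ->
  entire_coef (fun n => c1 n + c2 n).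
Proof.
move=> e1 e2 K K0; have [M1 H1] := e1 K K0; have [M2 H2] := e2 K K0.
exists (M1 + M2) => n; rewrite (le_trans _ (lerD (H1 n) (H2 n)))//.
by rewrite -mulrDl ler_wpM2r ?exprn_ge0 ?(ltW K0)// ler_normD.
Qed.

Lemma entire_coef_diffs c : entire_coef c -> entire_coef (pseries_diffs c).
Proof.
move=> /entire_coefM_nat ec K K0; have [M HM] := ec _ K0.
exists (M / K) => n; rewrite ler_pdivlMr// -mulrA -exprSr.
exact: HM n.+1.
Qed.

Lemma entire_cvg c x : entire_coef c -> cvgn (pseries c x).
Proof.
(* Twice [|x|] yields a geometric majorant of ratio 1/2; the added 1 keeps K positive at x = 0. *)
move=> ec; pose K := 2 * (`|x| + 1).
have x0 : 0 < `|x| + 1 by rewrite ltr_wpDl.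
have K0 : 0 < K by rewrite mulr_gt0.
have [M HM] := ec K K0.
have M0 : 0 <= M by apply: le_trans (HM 0%N); rewrite mulr_ge0// exprn_ge0// ltW.
apply: normed_cvg; apply: (@series_le_cvg _ _ (geometric M 2^-1)).
- by move=> n; rewrite normr_ge0.
- by move=> n; rewrite /geometric/= mulr_ge0// exprn_ge0// invr_ge0.
- move=> n; rewrite /geometric/= exprVn ler_pdivlMr ?exprn_gt0//.
  apply: le_trans (HM n); rewrite normrM normrX -mulrA -exprMn ler_wpM2l//.
  by rewrite lerXn2r ?nnegrE ?mulr_ge0// mulrC ler_wpM2l// lerDl.
- by apply: is_cvg_geometric_series; rewrite ger0_norm ?invr_ge0// invf_lt1// ltr1n.
Qed.

Lemma entire_is_derive c x : entire_coef c ->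
  is_derive x 1 (fun x => limn (pseries c x)) (limn (pseries (pseries_diffs c) x)).
Proof.
move=> ec; apply: (@pseries_snd_diffs _ _ (`|x| + 1)).
- exact: entire_cvg.
- by apply: entire_cvg; exact: entire_coef_diffs.
- by apply: entire_cvg; do 2 apply: entire_coef_diffs.
- by rewrite [ltRHS]ger0_norm ?addr_ge0// ltrDl.
Qed.

Lemma entire_coef_expfact k : entire_coef (fun n => k ^+ n / n`!%:R).
Proof.
move=> K K0; exists (expR (`|k| * K)) => n.
rewrite normrM normrX normfV normr_nat mulrAC -exprMn.
by apply: expR_ge_Xn; rewrite mulr_ge0// ltW.
Qed.

(** Multiplying the j-th coefficient by j is the Euler operator [x d/dx]. *)
Lemma limn_pseriesB_nat c (k l x : R) : entire_coef c ->
  limn (pseries (fun j => c j * (k * j%:R - l)) x) =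
  k * (x * limn (pseries (pseries_diffs c) x)) - l * limn (pseries c x).
Proof.
move=> ec; apply/cvg_lim => //.
have /pseries_diffs_equiv h1 : cvgn (pseries (pseries_diffs c) x).
  by apply: entire_cvg; exact: entire_coef_diffs.
have h2 : cvgn (pseries c x) by exact: entire_cvg.
rewrite mulrA; apply: cvg_trans (cvgB (cvgM (cvg_cst (k * x)) h1) (cvgM (cvg_cst l) h2)).
apply: near_eq_cvg; apply: nearW => N.
transitivity (k * x * series (fun i : nat => i%:R * c i * x ^+ i.-1) N - l * pseries c x N) => //.
rewrite /pseries /series/= !mulr_sumr -sumrB; apply: eq_bigr => i _.
case: i => [|i]; first by rewrite !expr0; ring.
by rewrite /= exprS; ring.
Qed.

End EntireSeries.

(** * The Fox-Wright function as a family of successive derivatives *)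

Section WrightSeries.
Context {R : realType}.
Variables nu t : R.
Hypothesis nu0 : 0 < nu.

(** The product is the falling factorial of [nu * j], that is Gamma(1 + nu j) / Gamma(1 - m + nu j),
    including the indices where the denominator has a pole. *)
Definition wright_coef m j : R := (- t) ^+ j / j`!%:R * \prod_(i < m) (nu * j%:R - i%:R).

Lemma wright_coefS m j : wright_coef m.+1 j = wright_coef m j * (nu * j%:R - m%:R).
Proof. by rewrite /wright_coef big_ord_recr/= mulrA. Qed.

Lemma entire_wright_coef m : entire_coef (wright_coef m).
Proof.
elim: m => [|m IH].
  rewrite (_ : wright_coef 0 = fun j => (- t) ^+ j / j`!%:R).
    exact: entire_coef_expfact.
  by apply/funext => j; rewrite /wright_coef big_ord0 mulr1.
rewrite (_ : wright_coef m.+1 =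
    fun j => nu * (j%:R * wright_coef m j) + (- m%:R) * wright_coef m j).
  apply: entire_coefD; apply: entire_coefZ => //; exact: entire_coefM_nat.
by apply/funext => j; rewrite wright_coefS; ring.
Qed.

Lemma wright_VE m (y : R) : wright_V nu (1 - m%:R) (- t * y) = limn (pseries (wright_coef m) y).
Proof.
rewrite /wright_V /fox_wright /pseries; congr (limn (series _)).
apply/funext => j; rewrite /fox_wright_term !big_seq1/= addrAC Gamma_ratio.
  rewrite /wright_coef exprMn.
  have -> : \prod_(i < m) (1 + nu * j%:R - 1 - i%:R) = \prod_(i < m) (nu * j%:R - i%:R).
    by apply: eq_bigr => i _; ring.
  ring.
by rewrite ltr_pwDl// mulr_ge0// ltW.
Qed.

(** The m-th derivative in l of [exp (- t l^nu)]: each [l ^ (nu j)] differentiated m times. *)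
Definition wright_H m (l : R) := l `^ (- m%:R) * limn (pseries (wright_coef m) (l `^ nu)).

(** The derivative of [l ^ (nu j - m)] brings out [nu j - m], the next factor of the falling
    factorial. Its part [nu j] comes from the chain rule through [l ^ nu], its part [- m] from the
    outer power. *)
Lemma is_derive_wright_H m (l : R) : 0 < l -> is_derive l 1 (wright_H m) (wright_H m.+1 l).
Proof.
move=> l0; rewrite /wright_H.
have dp a : is_derive l 1 (fun x : R => x `^ a) (a * l `^ (a - 1)).
  exact: is_derive1_powR.
have dQ := entire_is_derive (l `^ nu) (entire_wright_coef m).
have dc := @is_derive1_comp _ _ (fun x : R => x `^ nu) _ _ _ dQ (dp nu).
apply: is_derive_eq (is_deriveM (dp (- m%:R)) dc) _.
rewrite /GRing.scale/=.
have -> : limn (pseries (wright_coef m.+1) (l `^ nu)) =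
    nu * (l `^ nu * limn (pseries (pseries_diffs (wright_coef m)) (l `^ nu)))
    - m%:R * limn (pseries (wright_coef m) (l `^ nu)).
  rewrite -limn_pseriesB_nat; last exact: entire_wright_coef.
  by congr (limn (pseries _ _)); apply/funext => j; rewrite wright_coefS.
have -> : l `^ (- m.+1%:R) = l `^ (- m%:R) / l.
  rewrite -natr1 opprD powRB ?powRr1 ?(ltW l0)//.
  by rewrite (gt_eqF l0) implybT.
have -> : l `^ (nu - 1) = l `^ nu / l.
  by rewrite powRB ?powRr1 ?(ltW l0)// (gt_eqF l0) implybT.
have -> : l `^ (- m%:R - 1) = l `^ (- m%:R) / l.
  by rewrite powRB ?powRr1 ?(ltW l0)// (gt_eqF l0) implybT.
by ring.
Qed.

End WrightSeries.

(** * Exponentially weighted moments from the Laplace transform *)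

Section LaplaceMoments.
Context {R : realType} {d : measure_display} {T : measurableType d}.
Variables (P : probability T R) (Y : T -> R) (nu t : R).
Hypothesis nu0 : 0 < nu.
Hypothesis mY : measurable_fun [set: T] Y.
Hypothesis Y0 : forall w, 0 <= Y w.
Hypothesis laplaceY : forall l : R, 0 < l ->
  (\int[P]_w (expR (- l * Y w))%:E = (expR (- t * l `^ nu))%:E)%E.

Implicit Types (l : R) (m : nat).

Definition laplace_moment_fun m (l : R) (w : T) := Y w ^+ m * expR (- l * Y w).

Definition laplace_moment m (l : R) := \int[P]_w laplace_moment_fun m l w.

Lemma laplace_moment_fun_ge0 m l w : 0 <= laplace_moment_fun m l w.
Proof. by rewrite mulr_ge0 ?exprn_ge0 ?expR_ge0. Qed.

(** From [(l0 Y) ^ m / m! <= exp (l0 Y)]. The bound is a constant uniform in [l >= l0], hence gives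
    integrability without any moment assumption on Y and dominates the difference quotients. *)
Lemma laplace_moment_fun_le m l l0 w : 0 < l0 -> l0 <= l ->
  laplace_moment_fun m l w <= m`!%:R / l0 ^+ m.
Proof.
move=> l00 ll; rewrite /laplace_moment_fun mulNr expRN ler_pdivrMr ?expR_gt0//.
rewrite mulrAC ler_pdivlMr ?exprn_gt0// -exprMn mulrC.
rewrite [leRHS]mulrC -ler_pdivrMr ?ltr0n ?fact_gt0// (@le_trans _ _ (expR (l0 * Y w)))//.
  by apply: expR_ge_Xn; rewrite mulr_ge0 ?(ltW l00).
by rewrite ler_expR ler_wpM2r.
Qed.

Lemma measurable_laplace_moment_fun m l : measurable_fun [set: T] (laplace_moment_fun m l).
Proof.
apply: measurable_funM; first exact: measurable_funX.
apply: measurableT_comp => //; exact: measurable_funM.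
Qed.

Lemma integrable_laplace_moment_fun m l : 0 < l ->
  P.-integrable [set: T] (EFin \o laplace_moment_fun m l).
Proof.
move=> l0; apply: (@le_integrable _ _ _ _ _ _ _ (EFin \o cst (m`!%:R / l ^+ m))) => //.
- by apply/measurable_EFinP; exact: measurable_laplace_moment_fun.
- move=> w _ /=; rewrite lee_fin !ger0_norm ?laplace_moment_fun_ge0//.
    exact: laplace_moment_fun_le.
  by rewrite divr_ge0// exprn_ge0// ltW.
- exact: finite_measure_integrable_cst.
Qed.

Lemma is_derive_laplace_moment_fun m l w :
  is_derive l 1 (fun l => laplace_moment_fun m l w) (- laplace_moment_fun m.+1 l w).
Proof.
have h : is_derive l 1 (fun l : R => - l * Y w) (- Y w).
  by apply: is_derive_eq; rewrite scaler0 add0r -[_ *: _]/(_ * _) mulrN1.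
have := @is_derive1_comp _ expR (fun l : R => - l * Y w) _ _ _ (is_derive_expR (- l * Y w)) h.
move=> h2; have h3 := is_deriveZ (Y w ^+ m) h2.
apply: is_derive_eq h3 _.
by rewrite /laplace_moment_fun exprS -[_ *: _]/(_ * _); ring.
Qed.

Lemma is_derive_laplace_moment m l : 0 < l ->
  is_derive l 1 (laplace_moment m) (- laplace_moment m.+1 l).
Proof.
move=> l0.
(* A neighbourhood of l bounded away from 0, so that one constant, taken at [l / 2], dominates all
   derivatives. *)
have Il : `]l / 2, l + 1[%classic l by rewrite /= in_itv/=; apply/andP; split; lra.
have Ipos x : `]l / 2, l + 1[%classic x -> 0 < x.
  by rewrite /= in_itv/= => /andP[+ _]; apply: lt_trans; lra.
have i1 x : `]l / 2, l + 1[%classic x ->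
    P.-integrable [set: T] (EFin \o laplace_moment_fun m x).
  by move=> /Ipos; exact: integrable_laplace_moment_fun.
have i2 (x : R) (w : T) : `]l / 2, l + 1[%classic x -> [set: T] w ->
    derivable (fun x => laplace_moment_fun m x w) x 1.
  by move=> _ _; apply: ex_derive; exact: is_derive_laplace_moment_fun.
pose K : R := m.+1`!%:R / (l / 2) ^+ m.+1.
have K0 (w : T) : 0 <= cst K w by rewrite /= divr_ge0// exprn_ge0// divr_ge0// ltW.
have iK : P.-integrable [set: T] (EFin \o cst K) by exact: finite_measure_integrable_cst.
have dE x w : partial1of2 (laplace_moment_fun m) x w = - laplace_moment_fun m.+1 x w.
  by rewrite partial1of2E; apply: derive_val; exact: is_derive_laplace_moment_fun.
have i3 (x : R) (w : T) : `]l / 2, l + 1[%classic x -> [set: T] w ->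
    `|partial1of2 (laplace_moment_fun m) x w| <= cst K w.
  move=> xI _; rewrite dE normrN ger0_norm ?laplace_moment_fun_ge0//.
  apply: laplace_moment_fun_le; first by rewrite divr_gt0.
  by move: xI; rewrite /= in_itv/= => /andP[/ltW].
apply: DeriveDef.
  exact: (derivable_under_integral measurableT Il i1 i2 K0 iK i3).
rewrite -derive1E (differentiation_under_integral measurableT Il i1 i2 K0 iK i3).
rewrite -mulN1r -RintegralZl//; last exact: integrable_laplace_moment_fun.
by apply: eq_Rintegral => w _; rewrite dE mulN1r.
Qed.

Lemma laplace_momentE m l : 0 < l ->
  (-1) ^+ m * laplace_moment m l = wright_H nu t m l.
Proof.
elim: m l => [|m IH] l l0.
  rewrite mul1r /laplace_moment /laplace_moment_fun /Rintegral.
  under eq_integral do rewrite expr0 mul1r.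
  rewrite laplaceY//= /wright_H oppr0 powRr0 mul1r expRE /pseries.
  congr (limn (series _)); apply/funext => j.
  by rewrite /= /wright_coef big_ord0 mulr1 exprMn; ring.
have d1 := is_deriveZ ((-1) ^+ m) (is_derive_laplace_moment m l0).
have d2 := is_derive_wright_H nu t m l0.
(* The induction hypothesis holds on the whole open half-line, hence near l, and may be
   differentiated. *)
have : 'D_1 ((-1) ^+ m \*: laplace_moment m) l = 'D_1 (wright_H nu t m) l.
  apply: near_eq_derive => //; near=> x.
  rewrite /= -IH//.
  by near: x; exact: lt_nbhsr.
rewrite (@derive_val _ _ _ _ _ _ _ d1) (@derive_val _ _ _ _ _ _ _ d2) => <-.
by rewrite exprS -[_ *: _]/(_ * _); ring.
Unshelve. all: by end_near. Qed.

Lemma laplace_moment_wright_V m l : 0 < l ->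
  laplace_moment m l = (-1) ^+ m * l ^- m * wright_V nu (1 - m%:R) (- t * l `^ nu).
Proof.
move=> l0; rewrite wright_VE// -powR_invn ?(ltW l0)// -mulrA -/(wright_H nu t m l).
by rewrite -laplace_momentE// mulrA -expr2 sqrr_sign mul1r.
Qed.

End LaplaceMoments.

(** * Kolmogorov's backward equation *)

Section EsumRest.
Context {R : realType}.

(** With weights in [0, 1], the terms outside r add up to at most the mass that u leaves there. This
    turns the infinite Chapman-Kolmogorov sum into finitely many terms and a controlled error. *)
Lemma esum_seq_rest (I : choiceType) (u v : I -> R) (s : R) (r : seq I) : uniq r ->
  (forall j, 0 <= u j) -> (\esum_(j in [set: I]) (u j)%:E = 1)%E ->
  (forall j, 0 <= v j <= 1) ->
  (\esum_(j in [set: I]) (u j * v j)%:E = s%:E)%E ->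
  exists e, [/\ 0 <= e, e <= 1 - \sum_(j <- r) u j & s = \sum_(j <- r) u j * v j + e].
Proof.
move=> ur u0 u1 v01 uvs.
have v0 j : 0 <= v j by have /andP[] := v01 j.
have v1 j : v j <= 1 by have /andP[] := v01 j.
have split (f : I -> R) : (forall j, 0 <= f j) ->
    (\esum_(j in [set: I]) (f j)%:E =
     (\sum_(j <- r) f j)%:E + \esum_(j in ~` [set` r]) (f j)%:E)%E.
  move=> f0; rewrite (esumID [set` r])/=; last by move=> j _; rewrite lee_fin.
  rewrite !setTI esum_fset//; last first.
  - by move=> j _; rewrite lee_fin.
  by rewrite -fsbig_seq// sumEFin.
set ru := (\esum_(j in ~` [set` r]) (u j)%:E)%E.
set rv := (\esum_(j in ~` [set` r]) (u j * v j)%:E)%E.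
have ru0 : (0 <= ru)%E by apply: esum_ge0 => j _; rewrite lee_fin.
have rv0 : (0 <= rv)%E by apply: esum_ge0 => j _; rewrite lee_fin mulr_ge0.
have rvu : (rv <= ru)%E by apply: le_esum => j _; rewrite lee_fin ler_piMr.
have := split u u0; rewrite u1 -/ru => ruE.
have := split (fun j => u j * v j) (fun j => mulr_ge0 (u0 j) (v0 j)); rewrite uvs -/rv => rvE.
clearbody ru rv; case: ru ruE ru0 rvu => [ru| |]//= [ruE] _.
case: rv rvE rv0 => [rv| |]//= [rvE]; rewrite !lee_fin => rv0 rvu.
by exists rv; split => //; lra.
Qed.

End EsumRest.

Section TransitionFunction.
Context {R : realType}.
Variable p : R -> int -> int -> R.
Hypothesis tf : transition_function p.
Implicit Types (t h x y : R) (k n j : int).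

Lemma tf_le1 t k n : 0 <= t -> p t k n <= 1.
Proof.
move=> t0.
have h01 : int -> 0 <= (1 : R) <= 1 by move=> _; rewrite ler01 lexx.
have s1 : (\esum_(j in [set: int]) (p t k j * 1)%:E = 1)%E.
  by under eq_esum do rewrite mulr1; exact: (tf_sum tf).
have [e [e0 e1 e2]] := @esum_seq_rest R int (p t k) (fun=> 1) 1 [:: n] isT
  (fun j => tf_ge0 tf k j t0) (tf_sum tf k t0) h01 s1.
by move: e1; rewrite big_seq1 => e1; rewrite -subr_ge0; exact: le_trans e1.
Qed.

Lemma tf_rest h t k n (r : seq int) : uniq r -> 0 <= h -> 0 <= t ->
  exists e, [/\ 0 <= e, e <= 1 - \sum_(j <- r) p h k j &
    p (h + t) k n = \sum_(j <- r) p h k j * p t j n + e].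
Proof.
move=> ur h0 t0; apply: esum_seq_rest => //.
- by move=> j; exact: (tf_ge0 tf).
- exact: (tf_sum tf).
- by move=> j; rewrite (tf_ge0 tf)//= tf_le1.
- exact: (tf_chapman_kolmogorov tf).
Qed.

(** Condition on the state at time h: unless the chain is still at k, the error is at most the
    escaped mass. The modulus does not depend on t. *)
Lemma tf_incr h t k n : 0 <= h -> 0 <= t ->
  `|p (h + t) k n - p t k n| <= 1 - p h k k.
Proof.
move=> h0 t0; have [//|e [e0 e1 ->]] := @tf_rest h t k n [:: k] _ h0 t0.
rewrite !big_seq1 in e1 *.
have := tf_ge0 tf k n t0; have := tf_le1 k n t0.
have := tf_ge0 tf k k h0; have := tf_le1 k k h0 => a1 a2 a3 a4.
by rewrite ler_norml; apply/andP; split; nra.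
Qed.

End TransitionFunction.

Section Generator.
Context {R : realType}.
Variables (p : R -> int -> int -> R) (g : int -> int -> R).
Hypothesis tf : transition_function p.
Hypothesis hg : has_generator p g.
Implicit Types (t h x y : R) (k n j : int).

Lemma tf_cvg0 k j : p h k j @[h --> 0^'+] --> p 0 k j.
Proof.
have : h * ((p h k j - p 0 k j) / h) + p 0 k j @[h --> 0^'+] --> 0 * g k j + p 0 k j.
  apply: cvgD; last exact: cvg_cst.
  apply: cvgM; last exact: hg.
  by apply: cvg_at_right_filter; exact: cvg_id.
rewrite mul0r add0r; apply: cvg_trans; apply: near_eq_cvg.
near=> h.
have h0 : h != 0 by rewrite gt_eqF//; near: h; exact: nbhs_right_gt.
by rewrite mulrC divfK// subrK.
Unshelve. all: by end_near. Qed.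

(** Frozen at its value at 0 for negative times, where nothing is known of p; continuity,
    measurability and bounds then hold on all of R. *)
Definition tf_ext k n x := p (Num.max 0 x) k n.

Lemma tf_extE k n x : 0 <= x -> tf_ext k n x = p x k n.
Proof. by move=> x0; rewrite /tf_ext max_r. Qed.

Lemma tf_ext_ge0 k n x : 0 <= tf_ext k n x.
Proof. by apply: (tf_ge0 tf); rewrite le_max lexx. Qed.

Lemma tf_ext_le1 k n x : tf_ext k n x <= 1.
Proof. by apply: (tf_le1 tf); rewrite le_max lexx. Qed.

Lemma continuous_tf_ext k n : continuous (tf_ext k n).
Proof.
move=> x; apply/cvgrPdist_le => e e0.
have /cvgrPdist_le/(_ e e0) := @tf_cvg0 k k.
rewrite (tf_0 tf) eqxx/= => -[d /= d0 hd].
have om h : 0 <= h -> h < d -> 1 - p h k k <= e.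
  rewrite le_eqVlt => /predU1P[<- _|h0 hd0].
    by rewrite (tf_0 tf) eqxx subrr ltW.
  apply: le_trans (hd h _ h0); first by rewrite ler_norm.
  by rewrite /ball_/= sub0r normrN gtr0_norm.
have sym a b : a <= b -> b - a < d -> `|tf_ext k n b - tf_ext k n a| <= e.
  move=> ab bad; rewrite /tf_ext.
  set a' := Num.max 0 a; set b' := Num.max 0 b.
  have a0 : 0 <= a' by rewrite /a' le_max lexx.
  have [h0 hd0] : 0 <= b' - a' /\ b' - a' < d.
    by rewrite /a' /b'; case: (leP 0 a); case: (leP 0 b) => ? ?; split; lra.
  have := tf_incr tf k n h0 a0; rewrite subrK => /le_trans; apply.
  exact: om.
near=> y.
have yd : `|x - y| < d by near: y; apply/nbhs_ballP; exists d.
have [xy|yx] := leP x y.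
  rewrite distrC; apply: sym => //.
  by rewrite distrC in yd; apply: le_lt_trans yd; exact: ler_norm.
by apply: sym; [exact: ltW|apply: le_lt_trans yd; exact: ler_norm].
Unshelve. all: by end_near. Qed.

Hypothesis g_tri : forall k, g k k + g k (k + 1) + g k (k - 1) = 0.

(** The base point [tau h] serves both one-sided derivatives: [tau h = t] for the right one,
    [tau h = t - h] for the left one. By [g_tri] the mass leaving k beyond its two neighbours is
    o(h), and this squeezes the rest of the Chapman-Kolmogorov sum. *)
Lemma tf_backward_aux (tau : R -> R) t k n :
  (\forall h \near 0^'+, 0 <= tau h) ->
  (forall j, p (tau h) j n @[h --> 0^'+] --> p t j n) ->
  (p (h + tau h) k n - p (tau h) k n) / h @[h --> 0^'+] -->
  g k k * p t k n + g k (k + 1) * p t (k + 1) n + g k (k - 1) * p t (k - 1) n.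
Proof.
move=> tau0 ptau.
pose D j h := (p h k j - p 0 k j) / h.
pose L h := D k h * p (tau h) k n + D (k + 1) h * p (tau h) (k + 1) n +
  D (k - 1) h * p (tau h) (k - 1) n.
have cD j : D j h @[h --> 0^'+] --> g k j by exact: hg.
have cL : L h @[h --> 0^'+] -->
   g k k * p t k n + g k (k + 1) * p t (k + 1) n + g k (k - 1) * p t (k - 1) n.
  by apply: cvgD; first apply: cvgD; apply: cvgM.
apply: (@squeeze_cvgr _ _ _ _ L (fun h => L h - (D k h + D (k + 1) h + D (k - 1) h))) => //; last first.
  have c0 : L h - (D k h + D (k + 1) h + D (k - 1) h) @[h --> 0^'+] -->
      g k k * p t k n + g k (k + 1) * p t (k + 1) n + g k (k - 1) * p t (k - 1) n
      - (g k k + g k (k + 1) + g k (k - 1)).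
    by apply: cvgB => //; apply: cvgD => //; apply: cvgD.
  by rewrite g_tri subr0 in c0.
near=> h.
have h0 : 0 < h by near: h; exact: nbhs_right_gt.
have th0 : 0 <= tau h by near: h.
have [|e [e0 e1 ->]] := @tf_rest _ _ tf h (tau h) k n [:: k; k + 1; k - 1] _ (ltW h0) th0.
  by rewrite /= !inE; lia.
move: e1; rewrite !big_cons !big_nil => e1.
have k1 : (k == k + 1) = false by lia.
have k2 : (k == k - 1) = false by lia.
have -> : (p h k k * p (tau h) k n +
     (p h k (k + 1) * p (tau h) (k + 1) n +
      (p h k (k - 1) * p (tau h) (k - 1) n + 0)) + e - p (tau h) k n) / h = L h + e / h.
  by rewrite /L /D !(tf_0 tf) eqxx k1 k2/=; field; rewrite gt_eqF.
rewrite lerDl divr_ge0 ?(ltW h0)//= lerD2l.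
rewrite /D !(tf_0 tf) eqxx k1 k2/= -!mulrDl -mulNr ler_pM2r ?invr_gt0//.
by lra.
Unshelve. all: by end_near. Qed.

Lemma is_derive_tf t k n : 0 < t ->
  is_derive t 1 (fun t => p t k n)
    (g k k * p t k n + g k (k + 1) * p t (k + 1) n + g k (k - 1) * p t (k - 1) n).
Proof.
move=> t0; set L := (X in is_derive _ _ _ X).
suff cL : h^-1 *: (p (h + t) k n - p t k n) @[h --> 0^'] --> L.
  have cL' : h^-1 *: (((fun t => p t k n) \o shift t) (h *: 1) - p t k n) @[h --> 0^'] --> L.
    by under eq_fun do rewrite /= scaler1.
  by apply: DeriveDef; [apply/cvg_ex; exists L|exact: (cvg_lim _ cL')].
apply: (@cvg_at_right_left_dnbhs _ R^o).
  have := @tf_backward_aux (fun=> t) t k n; move=> /(_ _ _)/wrap[].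
  - by apply: nearW => _; exact: ltW.
  - by move=> j; exact: cvg_cst.
  apply: cvg_trans; apply: near_eq_cvg; apply: nearW => h /=.
  by rewrite -[_ *: _]/(_ * _) mulrC.
(* On the left the base point [t - h] moves with h, so continuity of p in time is required. *)
apply/cvg_at_leftNP; rewrite oppr0.
have := @tf_backward_aux (fun h => t - h) t k n.
have ct : t - h @[h --> 0^'+] --> t.
  rewrite -[X in _ --> X]subr0; apply: cvgB; first exact: cvg_cst.
  by apply: cvg_at_right_filter; exact: cvg_id.
move=> /(_ _ _)/wrap[].
- by near=> h; rewrite subr_ge0; near: h; apply: nbhs_right_le.
- move=> j; rewrite -(tf_extE _ _ (ltW t0)).
  have := cvg_comp _ _ ct (@continuous_tf_ext j n t).
  apply: cvg_trans; apply: near_eq_cvg; near=> h.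
  by rewrite /= tf_extE// subr_ge0; near: h; apply: nbhs_right_le.
apply: cvg_trans; apply: near_eq_cvg; near=> h => /=.
rewrite addrCA subrr addr0 -[_ *: _]/(_ * _) invrN mulNr -mulrN opprB mulrC.
by rewrite [- h + t]addrC.
Unshelve. all: by end_near. Qed.

End Generator.

Lemma is_derive_Xn (R : realType) (x : R) n :
  is_derive x 1 (fun x => x ^+ n) (n%:R * x ^+ n.-1).
Proof.
by apply: DeriveDef; [exact: exprn_derivable|rewrite exp_derive /GRing.scale/= mulr1].
Qed.

Lemma is_derive_ge0_le (R : realType) (F dF : R -> R) (T t : R) :
  (forall x : R, 0 < x -> is_derive x 1 F (dF x)) ->
  (forall x : R, 0 < x < T -> 0 <= dF x) ->
  {within `[0, T], continuous F} -> 0 <= t <= T -> F 0 <= F t.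
Proof.
move=> FdF dF0 cF /andP[t0 tT].
have T0 : 0 <= T by exact: le_trans tT.
have dF1 x : x \in `]0, T[ -> derivable F x 1.
  by rewrite in_itv/= => /andP[x0 _]; have [] := FdF x x0.
have dF2 x : x \in `]0, T[ -> 0 <= (F^`())%classic x.
  rewrite in_itv/= => xT; have /andP[x0 _] := xT.
  by rewrite derive1E (@derive_val _ _ _ _ _ _ _ (FdF x x0)) dF0.
have := ger0_derive1_le_cc dF1 dF2 cF.
by move=> /(_ 0 t); apply; rewrite ?in_itv/= ?lexx ?T0 ?t0.
Qed.

(** * The exponential series of a bounded generator *)

Section UniqueSeries.
Context {R : realType}.
Variables (p : R -> int -> int -> R) (up down : int -> R) (s : R).
Let g k n := if n == k + 1 then up k else if n == k - 1 then down k
  else if n == k then - (up k + down k) else 0.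
Hypothesis tf : transition_function p.
Hypothesis hg : has_generator p g.
Hypothesis up0 : forall k, 0 <= up k.
Hypothesis down0 : forall k, 0 <= down k.
Hypothesis ud_le : forall k, up k + down k <= 2 * s.
Implicit Types (t h x y : R) (k n j : int) (w : int -> R) (m : nat).

(** The operator [G + s] on functions of the starting state: [expR (s * t) * p t k n], as a function
    of k, solves [u' = (G + s) u]. *)
Definition shifted_gen w k :=
  up k * w (k + 1) + down k * w (k - 1) + (s - (up k + down k)) * w k.

Definition unit_vec n k : R := (k == n)%:R.

Definition gen_iter n m := iter m shifted_gen (unit_vec n).

Let gS k : g k (k + 1) = up k. Proof. by rewrite /g eqxx. Qed.
Let gP k : g k (k - 1) = down k.
Proof. by rewrite /g eqxx; case: eqP => //; lia. Qed.
Let gD k : g k k = - (up k + down k).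
Proof. by rewrite /g eqxx; case: eqP => [|_]; [lia|case: eqP => //; lia]. Qed.

(* Bounding this remainder by induction on m avoids a uniqueness theorem for
   the backward equation. *)
Definition gen_rem n m t k :=
  expR (s * t) * p t k n - \sum_(i < m) t ^+ i / i`!%:R * gen_iter n i k.

Let s0 : 0 <= s.
Proof. by have := up0 0; have := down0 0; have := ud_le 0; lra. Qed.

Lemma shifted_gen_sum (I : Type) (r : seq I) (c : I -> R) (v : I -> int -> R) k :
  shifted_gen (fun k => \sum_(i <- r) c i * v i k) k = \sum_(i <- r) c i * shifted_gen (v i) k.
Proof.
rewrite /shifted_gen !mulr_sumr -!big_split/=; apply: eq_bigr => i _; ring.
Qed.

Lemma shifted_genB w1 w2 k :
  shifted_gen (fun k => w1 k - w2 k) k = shifted_gen w1 k - shifted_gen w2 k.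
Proof. by rewrite /shifted_gen; ring. Qed.

(** The backward equation makes [G + s] act on the first term, and differentiating a Taylor sum
    drops one term and raises the iterate by one; hence the order falls from [m.+1] to m. *)
Lemma is_derive_gen_rem n m t k : 0 < t ->
  is_derive t 1 (fun t => gen_rem n m.+1 t k) (shifted_gen (gen_rem n m t) k).
Proof.
move=> t0.
have g0 j : g j j + g j (j + 1) + g j (j - 1) = 0 by rewrite gS gP gD; ring.
have := is_derive_tf tf hg g0 k n t0; rewrite gS gP gD => dp.
have de : is_derive t 1 (fun t => expR (s * t)) (expR (s * t) * s).
  have hl : is_derive t 1 (fun t : R => s * t) s.
    by apply: is_derive_eq (is_deriveZ s (is_derive_id t (1 : R))) _; rewrite /GRing.scale/= mulr1.
  exact: (@is_derive1_comp _ expR (fun t : R => s * t) _ _ _ (is_derive_expR (s * t)) hl).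
have dsum : is_derive t 1 (fun t => \sum_(i < m.+1) t ^+ i / i`!%:R * gen_iter n i k)
    (\sum_(i < m) t ^+ i / i`!%:R * gen_iter n i.+1 k).
  have -> : (fun t => \sum_(i < m.+1) t ^+ i / i`!%:R * gen_iter n i k) =
      \sum_(i < m.+1) (fun t => t ^+ i / i`!%:R * gen_iter n i k).
    by apply/funext => x; rewrite fct_sumE.
  have -> : \sum_(i < m) t ^+ i / i`!%:R * gen_iter n i.+1 k =
      \sum_(i < m.+1) i%:R * t ^+ i.-1 / i`!%:R * gen_iter n i k.
    rewrite big_ord_recl/= mul0r mul0r mul0r add0r; apply: eq_bigr => i _.
    rewrite /bump/= add1n factS natrM invfM; congr (_ * _).
    by rewrite mulrAC mulrA mulrAC divff ?pnatr_eq0// mul1r mulrC.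
  apply: is_derive_sum => i.
  have hX := is_derive_Xn t i.
  have := is_deriveZ (gen_iter n i k / i`!%:R) hX.
  rewrite (_ : _ \*: _ = (fun t => t ^+ i / i`!%:R * gen_iter n i k)); last first.
    by apply/funext => x /=; rewrite -[_ *: _]/(_ * _); ring.
  by move=> h; apply: is_derive_eq h _; rewrite -[_ *: _]/(_ * _); ring.
have h := is_deriveB (is_deriveM de dp) dsum.
apply: is_derive_eq h _.
have -> : gen_rem n m t = (fun k => (fun k => expR (s * t) * p t k n) k -
   (fun k => \sum_(i < m) t ^+ i / i`!%:R * gen_iter n i k) k) by [].
rewrite shifted_genB shifted_gen_sum; congr (_ - _).
by rewrite /shifted_gen -![_ *: _]/(_ * _); ring.
Qed.

(** The two jumps contribute at most [2 * s] and the diagonal at most s; 4 is a generous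
    constant. *)
Lemma shifted_gen_le w k M : (forall k, `|w k| <= M) ->
  `|shifted_gen w k| <= 4 * s * M.
Proof.
move=> wM; rewrite /shifted_gen.
have h1 := up0 k; have h2 := down0 k; have h3 := ud_le k.
have M0 : 0 <= M by apply: le_trans (wM k).
have a3 : `|s - (up k + down k)| <= s by rewrite ler_norml; lra.
have : `|up k * w (k + 1) + down k * w (k - 1) + (s - (up k + down k)) * w k| <=
   up k * M + down k * M + s * M.
  apply: le_trans (ler_normD _ _) _; apply: lerD; last first.
    by rewrite normrM ler_pM.
  apply: le_trans (ler_normD _ _) _; apply: lerD.
    by rewrite normrM ger0_norm// ler_wpM2l.
  by rewrite normrM ger0_norm// ler_wpM2l.
by move/le_trans; apply; nra.
Qed.

Lemma gen_rem0 n m k : gen_rem n m.+1 0 k = 0.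
Proof.
rewrite /gen_rem mulr0 expR0 mul1r (tf_0 tf) big_ord_recl/= expr0 fact0 divr1 mul1r.
rewrite big1 ?addr0 ?subrr// => i _.
by rewrite /bump/= add1n expr0n/= mul0r mul0r.
Qed.

Lemma continuous_gen_rem n m k (T : R) : 0 < T ->
  {within `[0, T], continuous (fun t => gen_rem n m t k)}.
Proof.
move=> T0.
have c1 : continuous (fun t => expR (s * t) * tf_ext p k n t -
    \sum_(i < m) t ^+ i / i`!%:R * gen_iter n i k).
  move=> t; apply: cvgB.
    apply: cvgM; last exact: (continuous_tf_ext tf hg).
    apply: (@continuous_comp _ _ _ (fun t => s * t) expR); last exact: continuous_expR.
    exact: mulrl_continuous.
  have := fun i : 'I_m => is_deriveZ (gen_iter n i k / i`!%:R) (is_derive_Xn t i).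
  move=> /is_derive_sum [dS _].
  suff : {for t, continuous (fun t => \sum_(i < m) t ^+ i / i`!%:R * gen_iter n i k)} by [].
  have fE : (fun t => \sum_(i < m) t ^+ i / i`!%:R * gen_iter n i k) =
      \sum_(i < m) (gen_iter n i k / i`!%:R) \*: (GRing.exp (R:=R))^~ i.
    apply/funext => x; rewrite fct_sumE; apply: eq_bigr => i _ /=.
    by rewrite /GRing.scale/=; ring.
  by rewrite fE; apply: differentiable_continuous; apply/derivable1_diffP.
have := continuous_subspaceT c1 (A := `[0, T]%classic).
apply: subspace_eq_continuous => x; rewrite inE/= in_itv/= => /andP[x0 _].
by rewrite /from_subspace /gen_rem tf_extE.
Qed.

(** Induction on m for all states together, since the derivative at k involves its neighbours. The
    derivative of the new bound is [4 * s] times the old one, so it dominates that of the remainder,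
    and both vanish at 0; the sign e, used at 1 and -1, gives the two sides of the absolute
    value. *)
Lemma gen_rem_le n m k t (T : R) : 0 < T -> 0 <= t <= T ->
  `|gen_rem n m t k| <= expR (s * T) * ((4 * s * t) ^+ m / m`!%:R).
Proof.
move=> T0; elim: m k t => [|m IH] k t /andP[t0 tT].
  rewrite /gen_rem big_ord0 subr0 fact0 expr0 divr1 mulr1.
  rewrite ger0_norm ?mulr_ge0 ?expR_ge0//; last exact: (tf_ge0 tf).
  rewrite -[leRHS]mulr1 ler_pM ?expR_ge0//; first exact: (tf_ge0 tf).
    by rewrite ler_expR ler_wpM2l.
  exact: (tf_le1 tf).
pose M : R := expR (s * T).
pose G (x : R) := M * ((4 * s * x) ^+ m.+1 / m.+1`!%:R).
have dG (x : R) : is_derive x 1 G (4 * s * (M * ((4 * s * x) ^+ m / m`!%:R))).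
  have hX := is_derive_Xn x m.+1.
  have := is_deriveZ (M * (4 * s) ^+ m.+1 / m.+1`!%:R) hX.
  rewrite (_ : _ \*: _ = G); last first.
    by apply/funext => y /=; rewrite /G !exprMn -[_ *: _]/(_ * _); ring.
  move=> h; apply: is_derive_eq h _.
  rewrite -[_ *: _]/(_ * _) factS natrM !exprMn !exprS; field.
  by rewrite pnatr_eq0 -lt0n fact_gt0 addrC natr1 pnatr_eq0.
have cG : {within `[0, T], continuous G}.
  apply: continuous_subspaceT => x; apply: differentiable_continuous.
  by apply/derivable1_diffP; exact: ex_derive.
suff main (e : R) : `|e| = 1 -> 0 <= G t - e * gen_rem n m.+1 t k.
  rewrite -/M -/(G t) ler_norml; apply/andP; split.
    by have := main (-1); rewrite normrN normr1 => /(_ erefl); lra.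
  by have := main 1; rewrite normr1 => /(_ erefl); lra.
move=> e1.
have dF x : 0 < x -> is_derive x 1 (fun x => G x - e * gen_rem n m.+1 x k)
    (4 * s * (M * ((4 * s * x) ^+ m / m`!%:R)) - e * shifted_gen (gen_rem n m x) k).
  move=> x0; have := is_deriveB (dG x) (is_deriveZ e (is_derive_gen_rem n m k x0)).
  exact.
have F0 : G 0 - e * gen_rem n m.+1 0 k = 0.
  by rewrite gen_rem0 /G mulr0 expr0n/= mul0r !mulr0 subr0.
rewrite -F0.
have dge0 x : 0 < x < T -> 0 <= 4 * s * (M * ((4 * s * x) ^+ m / m`!%:R)) -
    e * shifted_gen (gen_rem n m x) k.
  move=> /andP[x0 xT]; rewrite subr_ge0.
  apply: le_trans (ler_norm _) _; rewrite normrM e1 mul1r.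
  by apply: shifted_gen_le => j; apply: IH; rewrite !ltW.
have cF : {within `[0, T], continuous (fun x => G x - e * gen_rem n m.+1 x k)}.
  have cR := @continuous_gen_rem n m.+1 k T T0.
  move=> x; apply: cvgB; first exact: cG.
  by apply: cvgM; [exact: cvg_cst|exact: (cR x)].
have tI : 0 <= t <= T by rewrite t0.
exact: (is_derive_ge0_le dF dge0 cF tI).
Qed.

Lemma tf_series n k t : 0 <= t ->
  \sum_(i < m) t ^+ i / i`!%:R * gen_iter n i k @[m --> \oo] --> expR (s * t) * p t k n.
Proof.
move=> t0; suff h : `|\sum_(i < m) t ^+ i / i`!%:R * gen_iter n i k - expR (s * t) * p t k n|
    @[m --> \oo] --> 0 by apply/subr_cvg0; exact: norm_cvg0 h.
(* The horizon [t + 1] is positive even when t = 0. *)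
have t1 : 0 < t + 1 by rewrite ltr_wpDl.
apply: (@squeeze_cvgr _ _ _ _ (cst 0)
  (fun m => expR (s * (t + 1)) * ((4 * s * t) ^+ m / m`!%:R))).
- apply: nearW => m; rewrite normr_ge0/= distrC.
  by apply: gen_rem_le => //; rewrite t0 lerDl ler01.
- exact: cvg_cst.
- rewrite -(mulr0 (expR (s * (t + 1)))); apply: cvgM; first exact: cvg_cst.
  exact: cvg_exp_coeff.
Qed.

End UniqueSeries.

(** * The two-step walk on cells *)

Section IntCoef.
Context {F : fieldType}.
Implicit Types (q : {poly F}) (i k : int) (n m h l : nat).

(** Integer indices allow displacements [s - r] of either sign without case distinctions. *)
Definition coefz q i : F := if i is Posz j then q`_j else 0.

Lemma coefz_neg q i : i < 0 -> coefz q i = 0.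
Proof. by case: i. Qed.

Lemma coefz_Xn q n i : coefz ('X^n * q) i = coefz q (i - n%:Z).
Proof.
case: i => [j|j] /=; last by rewrite coefz_neg//; lia.
rewrite coefXnM; case: ltnP => jn; first by rewrite coefz_neg//; lia.
by rewrite subzn.
Qed.

Lemma coefz_C c q i : coefz (c%:P * q) i = c * coefz q i.
Proof. by case: i => j /=; rewrite ?mulr0// coefCM. Qed.

Lemma coefzD q1 q2 i : coefz (q1 + q2) i = coefz q1 i + coefz q2 i.
Proof. by case: i => j /=; rewrite ?addr0// coefD. Qed.

Lemma coefz_sum (I : Type) (r : seq I) (f : I -> {poly F}) i :
  coefz (\sum_(j <- r) f j) i = \sum_(j <- r) coefz (f j) i.
Proof. by case: i => j /=; rewrite ?coef_sum// big1. Qed.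

Lemma coef_affineX (x y : F) m l :
  ((x%:P + y%:P * 'X) ^+ m)`_l = 'C(m, l)%:R * x ^+ (m - l) * y ^+ l.
Proof.
rewrite exprDn coef_sum.
under eq_bigr => i _ do
  rewrite coefMn exprMn -!polyC_exp coefCM coefCM coefXn -mulrnAr.
have [lm|ml] := ltnP l m.+1; last first.
  rewrite bin_small// !mul0r big1// => i _.
  by rewrite (_ : (l == i) = false) ?mulr0 ?mul0rn ?mulr0//; have := ltn_ord i; lia.
rewrite (bigD1 (Ordinal lm))//= eqxx big1 ?addr0 => [|i il]; last first.
  rewrite (_ : (l == i) = false) ?mulr0 ?mul0rn ?mulr0//.
  by apply/negP => /eqP li; move: il; rewrite -val_eqE/= li eqxx.
by rewrite mulr1 -mulr_natl; ring.
Qed.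

Lemma sum_ord_shift (j N : nat) (G : nat -> F) : (forall h, (h < j)%N -> G h = 0) ->
  \sum_(h < (N + j)%N) G h = \sum_(m < N) G (m + j)%N.
Proof.
move=> G0; rewrite -(big_mkord xpredT G) (@big_cat_nat _ _ _ j)//= ?leq_addl//.
rewrite big_nat big1 ?add0r; last by move=> h /andP[_]; exact: G0.
by rewrite -[X in \sum_(X <= _ < _) _]add0n big_addn addnK big_mkord.
Qed.

End IntCoef.

Section CellWalk.
Context {R : realType}.
Variables a1 a2 b1 b2 : R.
Implicit Types (k r s : int) (n m h l : nat).

Let D4 : R := (b1 + b2 - a1 - a2) ^+ 2 / 4.

(* The symbol of the walk multiplied by u and reversed: the coefficient of u^k
   in its n-th power is that of 'X^(n - k) in cell_poly ^+ n. *)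
Definition cell_fact : {poly R} :=
  (a1%:P + a2%:P * 'X) * (b1%:P + b2%:P * 'X).

Definition cell_poly : {poly R} := D4%:P * 'X + cell_fact.

Definition cell_coef n k : R := coefz (cell_poly ^+ n) (n%:Z - k).

Lemma cell_coef0 k : cell_coef 0 k = (k == 0)%:R.
Proof.
rewrite /cell_coef expr0 sub0r.
case: k => [[|k]|k] //=; first by rewrite coefC.
by rewrite coefC.
Qed.

(** One more factor [cell_poly]; the resulting three-term recursion is the one satisfied by the
    squared shifted generator. *)
Lemma cell_coefS n k : cell_coef n.+1 k =
  a1 * b1 * cell_coef n (k - 1) + a2 * b2 * cell_coef n (k + 1) +
  (a1 * b2 + a2 * b1 + D4) * cell_coef n k.
Proof.
rewrite /cell_coef exprS.
have -> : cell_poly * cell_poly ^+ n =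
  (a1 * b1)%:P * cell_poly ^+ n +
  ((a2 * b2)%:P * ('X^2 * cell_poly ^+ n) +
   (a1 * b2 + a2 * b1 + D4)%:P * ('X^1 * cell_poly ^+ n)).
  rewrite {1}/cell_poly /cell_fact !polyCD !polyCM expr1.
  move: (cell_poly ^+ n) (a1%:P) (a2%:P) (b1%:P) (b2%:P) (D4%:P) 'X => q x1 x2 y1 y2 z X.
  by ring.
rewrite !coefzD !coefz_C !coefz_Xn addrA.
by congr (_ * coefz _ _ + _ * coefz _ _ + _ * coefz _ _); lia.
Qed.

Let sig := (a1 + a2 + b1 + b2) / 2.

Lemma D4_ge0 : 0 <= D4.
Proof. by rewrite divr_ge0// sqr_ge0. Qed.

(** A step changes the cell by at most one; this is why the final series may start at the distance
    between the cells. *)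
Lemma cell_coef_small n k : (n < `|k|)%N -> cell_coef n k = 0.
Proof.
elim: n k => [|n IH] k nk.
  by rewrite cell_coef0; case: k nk => [[|k]|k].
by rewrite cell_coefS !IH ?mulr0 ?addr0//; lia.
Qed.

Lemma cell_fact_coef m h : (cell_fact ^+ m)`_h =
  \sum_(l < h.+1) ('C(m, l)%:R * 'C(m, h - l)%:R) *
    (a1 ^+ (m - l) * a2 ^+ l * b1 ^+ (m - (h - l)) * b2 ^+ (h - l)).
Proof.
rewrite /cell_fact exprMn coefM; apply: eq_bigr => l _.
by rewrite !coef_affineX; ring.
Qed.

(** Expanding in powers of [D4] produces the outer sum of [theta_coef], with [m = h + k]. *)
Lemma cell_coef_fact n k : cell_coef n k =
  \sum_(m < n.+1) 'C(n, m)%:R * D4 ^+ (n - m) * coefz (cell_fact ^+ m) (m%:Z - k).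
Proof.
rewrite /cell_coef /cell_poly exprDn coefz_sum; apply: eq_bigr => m _.
have mn : (m <= n)%N by have := ltn_ord m; lia.
rewrite exprMn -polyC_exp -mulr_natl -!mulrA -[_%:R]/(1 *+ _) -polyCMn coefz_C coefz_C coefz_Xn mulrA.
by rewrite -mulrA; congr (_ * (_ * coefz _ _)); lia.
Qed.

Lemma binz_nat m l : binz m%:Z l%:Z = 'C(m, l)%:R :> R.
Proof. by []. Qed.

Lemma nterms_nat (n : nat) : nterms n%:Z = n.+1.
Proof. by []. Qed.

(** The substitution [m = h + k]. For k > 0 the small m have no partner h, for k < 0 the small h
    have no partner m; the two vanishing hypotheses cover these surplus terms. *)
Lemma sum_binz_shift (G Fm : nat -> R) n k :
  (forall h, h%:Z + k < 0 -> G h = 0) ->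
  (forall m, m%:Z - k < 0 -> Fm m = 0) ->
  (forall m h, m%:Z - k = h%:Z -> (m <= n)%N -> G h = Fm m) ->
  \sum_(h < nterms (n%:Z - k)) G h = \sum_(m < n.+1) Fm m.
Proof.
case: k => [j|j] G0 F0 GF.
  have [jn|nj] := leqP j n; last first.
    rewrite /nterms ifF ?big_ord0 ?big1//; last by lia.
    by move=> m _; rewrite F0//; have := ltn_ord m; lia.
  have -> : n.+1 = ((n - j).+1 + j)%N by lia.
  rewrite sum_ord_shift => [|h hj]; last by rewrite F0//; lia.
  rewrite subzn// nterms_nat; apply: eq_bigr => h _.
  by apply: GF; have := ltn_ord h; lia.
have -> : nterms (n%:Z - Negz j) = (n.+1 + j.+1)%N.
  by rewrite NegzE opprK -PoszD nterms_nat; lia.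
rewrite sum_ord_shift => [|h hj]; last by rewrite G0// NegzE; lia.
apply: eq_bigr => m _; apply: GF; last by have := ltn_ord m; lia.
by rewrite NegzE; lia.
Qed.

Hypotheses (a10 : 0 < a1) (a20 : 0 < a2) (b10 : 0 < b1) (b20 : 0 < b2).

Lemma cell_coef_bounds n k : 0 <= cell_coef n k <= sig ^+ (2 * n).
Proof.
have D0 := D4_ge0.
elim: n k => [|n IH] k.
  by rewrite cell_coef0 expr0; case: (k == 0); rewrite ?lexx ?ler01.
rewrite cell_coefS.
have /andP[p1 q1] := IH (k - 1).
have /andP[p2 q2] := IH (k + 1).
have /andP[p3 q3] := IH k.
have c1 : 0 < a1 * b1 by rewrite mulr_gt0.
have c2 : 0 < a2 * b2 by rewrite mulr_gt0.
have c3 : 0 <= a1 * b2 + a2 * b1 + D4 by rewrite !addr_ge0// mulr_ge0// ltW.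
apply/andP; split.
  by rewrite !addr_ge0// mulr_ge0// ltW.
(* The weights of one step sum to [(a1 + a2) (b1 + b2) + delta^2 / 4 = sig^2]. *)
have -> : sig ^+ (2 * n.+1) = (a1 * b1 + a2 * b2 + (a1 * b2 + a2 * b1 + D4)) * sig ^+ (2 * n).
  by rewrite mulnS exprD; congr (_ * _); rewrite /sig /D4; field.
rewrite !mulrDl -!mulrDl [leRHS]mulrDl [X in _ <= X + _]mulrDl.
by apply: lerD; [apply: lerD|]; apply: ler_wpM2l => //; exact: ltW.
Qed.

(* The weight of the paths in which l of the m steps from an even site and h - l
   of the m steps from an odd site go left. *)
Lemma weight_monomial m h k l : m%:Z - k = h%:Z -> (l <= h)%N -> (l <= m)%N -> (h - l <= m)%N ->
  (a1 * b1) ^ k * ((a1 * b2) ^+ h * (a2 * b1 / (a1 * b2)) ^+ l) =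
  a1 ^+ (m - l) * a2 ^+ l * b1 ^+ (m - (h - l)) * b2 ^+ (h - l).
Proof.
move=> mkh lh lm hlm.
have a1n : a1 != 0 by rewrite gt_eqF.
have a2n : a2 != 0 by rewrite gt_eqF.
have b1n : b1 != 0 by rewrite gt_eqF.
have b2n : b2 != 0 by rewrite gt_eqF.
have -> : k = m%:Z - h%:Z by rewrite -mkh subKr.
rewrite expfzDr ?mulf_neq0// -exprnP -exprnN.
rewrite !exprB ?unitfE// !exprMn !exprVn !exprMn.
have ne (x : R) i : x != 0 -> x ^+ i != 0 by move=> x0; rewrite expf_eq0 (negbTE x0) andbF.
have := (ne a1 m a1n, ne a1 h a1n, ne a1 l a1n, ne a2 l a2n,
 (ne b1 m b1n, ne b1 h b1n, ne b1 l b1n, ne b2 h b2n, ne b2 l b2n)).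
move: (a1 ^+ m) (a1 ^+ h) (a1 ^+ l) (a2 ^+ l) (b1 ^+ m) (b1 ^+ h) (b1 ^+ l) (b2 ^+ h) (b2 ^+ l).
move=> x1 x2 x3 x4 x5 x6 x7 x8 x9 [[[[h1 h2] h3] h4] [[[[h5 h6] h7] h8] h9]].
by field; rewrite h2 h3 h6 h7 h9.
Qed.

Lemma weighted_cell_fact_coef m h k : m%:Z - k = h%:Z ->
  (a1 * b1) ^ k * ((a1 * b2) ^+ h *
     \sum_(l < h.+1) (binz m%:Z l%:Z * binz m%:Z (h%:Z - l%:Z) * (a2 * b1 / (a1 * b2)) ^+ l))
  = (cell_fact ^+ m)`_h.
Proof.
move=> mkh; rewrite cell_fact_coef !mulr_sumr; apply: eq_bigr => l _.
have lh : (l <= h)%N by have := ltn_ord l; lia.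
rewrite subzn// !binz_nat.
have [lm|ml] := leqP l m; last by rewrite bin_small// !(mul0r, mulr0).
have [hlm|mhl] := leqP (h - l) m; last by rewrite [X in _ * X%:R]bin_small// !(mul0r, mulr0).
by rewrite -(weight_monomial mkh lh lm hlm); ring.
Qed.


(** The denominators of [theta_coef] are [4 * D4], nonzero by assumption. With [m = h + s - r] the
    powers of [D4] combine to [n - (s - r) - h = n - m], the exponent in the binomial expansion of
    [cell_poly]. *)
Lemma theta_coefE r s n : a1 + a2 != b1 + b2 ->
  ((b1 + b2 - a1 - a2) / 2) ^+ (2 * n) * (a1 * b1 / (a2 * b2)) ^ (s - r) *
    theta_coef a1 a2 b1 b2 r s n = cell_coef n (s - r).
Proof.
move=> ab; set k := s - r.
have dn : a1 + a2 - b1 - b2 != 0 by rewrite -addrA -opprD subr_eq0.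
have D4E : (a1 + a2 - b1 - b2) ^+ 2 = 4 * D4 by rewrite /D4; field.
have D40 : D4 != 0.
  by apply: contraNneq dn => D40; move: D4E; rewrite D40 mulr0 => /eqP; rewrite expf_eq0.
have -> : ((b1 + b2 - a1 - a2) / 2) ^+ (2 * n) = D4 ^+ n.
  by rewrite exprM; congr (_ ^+ n); rewrite /D4; field.
have a1n : a1 != 0 by rewrite gt_eqF.
have a2n : a2 != 0 by rewrite gt_eqF.
have b1n : b1 != 0 by rewrite gt_eqF.
have b2n : b2 != 0 by rewrite gt_eqF.
rewrite /theta_coef D4E -/k.
have -> : 4 * a2 * b2 / (4 * D4) = a2 * b2 / D4 by field.
have -> : 4 * a1 * b2 / (4 * D4) = a1 * b2 / D4 by field.
have -> : n%:Z - s + r = n%:Z - k by rewrite /k opprB [r - s]addrC addrA.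
rewrite mulrA -[_ * _ ^ k * _ ^ k]mulrA -expfzMl.
have -> : a1 * b1 / (a2 * b2) * (a2 * b2 / D4) = a1 * b1 * D4^-1 by field; rewrite D40 a2n b2n.
rewrite expfzMl mulr_sumr cell_coef_fact.
apply: (@sum_binz_shift (fun h : nat => D4 ^+ n * ((a1 * b1) ^ k * D4^-1 ^ k) *
     (binz n%:Z (h%:Z + s - r) * (a1 * b2 / D4) ^+ h *
      \sum_(l < h.+1)
         (binz (h%:Z + s - r) l%:Z * binz (h%:Z + s - r) (h%:Z - l%:Z) *
         (a2 * b1 / (a1 * b2)) ^+ l))) (fun m => 'C(n, m)%:R * D4 ^+ (n - m) * coefz (cell_fact ^+ m) (m%:Z - k))).
- move=> h hk; rewrite {1}/binz ifF ?mul0r ?mulr0//.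
  by apply/negP => /andP[_]; rewrite -addrA leNgt hk.
- by move=> m mk; rewrite coefz_neg// mulr0.
- move=> m h mkh mn; have -> : h%:Z + s - r = m%:Z by rewrite -addrA -/k -mkh subrK.
  rewrite mkh binz_nat /=.
  have := weighted_cell_fact_coef mkh.
  set S := \sum_(l < h.+1) _ => <-.
  have -> : D4^-1 ^ k = D4 ^+ h / D4 ^+ m.
    have -> : k = m%:Z - h%:Z by rewrite -mkh subKr.
    rewrite expfzDr ?invr_neq0// -exprnP -exprnN exprVn exprVn invrK mulrC//.
  rewrite [(a1 * b2 / D4) ^+ h]exprMn exprVn exprB ?unitfE//.
  have ne i : D4 ^+ i != 0 by rewrite expf_eq0 (negbTE D40) andbF.
  have := (ne n, ne m, ne h).
  move: (D4 ^+ n) (D4 ^+ m) (D4 ^+ h) => x1 x2 x3 [[h1 h2] h3].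
  by field; rewrite h2 h3.
Qed.

(** Here [D4 = 0], so only the product [cell_fact] remains and no outer sum appears. *)
Lemma eta_coefE r s n : a1 + a2 = b1 + b2 ->
  (a1 * b1 / (a2 * b2)) ^ (s - r) * eta_coef a1 a2 b1 b2 r s n = cell_coef n (s - r).
Proof.
move=> ab; set k := s - r.
have D40 : D4 = 0 by rewrite /D4 -addrA -opprD ab subrr expr0n/= mul0r.
have a1n : a1 != 0 by rewrite gt_eqF.
have a2n : a2 != 0 by rewrite gt_eqF.
have b1n : b1 != 0 by rewrite gt_eqF.
have b2n : b2 != 0 by rewrite gt_eqF.
rewrite /eta_coef -/k.
have -> : n%:Z - s + r = n%:Z - k by rewrite /k opprB [r - s]addrC addrA.
have -> : cell_coef n k = coefz (cell_fact ^+ n) (n%:Z - k).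
  by rewrite /cell_coef /cell_poly D40 mul0r add0r.
case: (ltP (n%:Z - k) 0) => nk.
  rewrite coefz_neg// /nterms ifF ?big_ord0 ?mulr0//; lia.
have [h nkh] : exists h : nat, n%:Z - k = h%:Z by exists `|(n%:Z - k)%R|%N; lia.
rewrite nkh nterms_nat /= -(weighted_cell_fact_coef nkh).
rewrite !mulrA -expfzMl.
have -> : a1 * b1 / (a2 * b2) * (a2 / a1) = a1 * b1 * (a1 * b2)^-1.
  by field; rewrite a1n a2n b2n.
rewrite expfzMl.
have -> : (a1 * b2)^-1 ^ k = (a1 * b2) ^+ h / (a1 * b2) ^+ n.
  have -> : k = n%:Z - h%:Z by rewrite -nkh subKr.
  by rewrite expfzDr ?invr_neq0 ?mulf_neq0// -exprnP -exprnN exprVn exprVn invrK mulrC.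
rewrite -!mulrA; congr (_ * (_ * _)).
rewrite mulKf ?expf_neq0 ?mulf_neq0//; apply: eq_bigr => l _.
have lh : (l <= h)%N by have := ltn_ord l; lia.
congr (_ * _ * _).
(* As [k + l = n - (h - l)], the second binomials agree by symmetry; if [k + l] is negative then
   [h - l > n] and both vanish. *)
case: (leP 0 (k + l%:Z)) => kl; last first.
  rewrite subzn// binz_nat bin_small; last by lia.
  by rewrite /binz; case: ifP => // /andP[_]; rewrite leNgt; lia.
have -> : k + l%:Z = (n - (h - l))%N%:Z by lia.
by rewrite subzn// !binz_nat bin_sub//; lia.
Qed.

End CellWalk.

Section CellSwap.
Context {R : realType}.

(** The exchange permutes two commuting factors and changes only the sign of [delta]; odd starting
    sites thus reuse the coefficients of even ones. *)
Lemma cell_coef_swap (a1 a2 b1 b2 : R) n k : cell_coef b1 b2 a1 a2 n k = cell_coef a1 a2 b1 b2 n k.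
Proof.
rewrite /cell_coef; congr (coefz (_ ^+ n) _); rewrite /cell_poly /cell_fact.
have -> : (a1 + a2 - b1 - b2) ^+ 2 = (b1 + b2 - a1 - a2) ^+ 2 by ring.
by congr (_ + _); exact: mulrC.
Qed.

End CellSwap.

Definition parity_rate (R : realType) (x y : R) (k : int) : R :=
  if (2 %| k)%Z then x else y.

Section GenIterCell.
Context {R : realType}.
Variables (a1 a2 b1 b2 : R).
Let up := parity_rate a1 b1.
Let down := parity_rate a2 b2.
Let sg : R := (a1 + a2 + b1 + b2) / 2.
Implicit Types (k n j : int) (m : nat).
Local Notation B := (shifted_gen up down sg).
Local Notation gi := (gen_iter up down sg).

Let par1 k : (2 %| k + 1)%Z = ~~ (2 %| k)%Z. Proof. lia. Qed.
Let parN1 k : (2 %| k - 1)%Z = ~~ (2 %| k)%Z. Proof. lia. Qed.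

(** The diagonal is [delta / 2] or [- delta / 2] by parity: its square does not see the parity, and
    the contributions of [k + 1] and [k - 1] cancel. A double jump uses one rate of each parity, in
    either order. *)
Lemma shifted_gen2 (w : int -> R) k : B (B w) k =
  a1 * b1 * w (k + 2) + a2 * b2 * w (k - 2) +
  (a1 * b2 + a2 * b1 + (b1 + b2 - a1 - a2) ^+ 2 / 4) * w k.
Proof.
rewrite /shifted_gen /up /down /parity_rate !par1 !parN1.
have -> : k + 1 + 1 = k + 2 by lia.
have -> : k - 1 - 1 = k - 2 by lia.
rewrite addrK subrK /sg.
by case: (2 %| k)%Z => /=; field.
Qed.

Lemma gen_iterS n m k : gi n m.+1 k =
  up k * gi n m (k + 1) + down k * gi n m (k - 1) + (sg - (up k + down k)) * gi n m k.
Proof. by []. Qed.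

Lemma gen_iterSS n m k : gi n (2 * m.+1) k =
  a1 * b1 * gi n (2 * m) (k + 2) + a2 * b2 * gi n (2 * m) (k - 2) +
  (a1 * b2 + a2 * b1 + (b1 + b2 - a1 - a2) ^+ 2 / 4) * gi n (2 * m) k.
Proof. by rewrite mulnS add2n -shifted_gen2. Qed.

Lemma gen_iter_even n m k j : n = k + 2 * j ->
  gi n (2 * m) k = cell_coef a1 a2 b1 b2 m j.
Proof.
elim: m k j => [|m IH] k j nkj.
  rewrite muln0 cell_coef0 /gen_iter/= /unit_vec; congr (_%:R); congr nat_of_bool.
  by apply/eqP/eqP; lia.
rewrite gen_iterSS (IH k j)// (IH (k + 2) (j - 1)); last by lia.
rewrite (IH (k - 2) (j + 1)); last by lia.
by rewrite [RHS]cell_coefS.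
Qed.

Lemma gen_iter_odd n m k j : n = k + 2 * j + 1 -> gi n (2 * m) k = 0.
Proof.
elim: m k j => [|m IH] k j nkj.
  rewrite muln0 /gen_iter/= /unit_vec (_ : (_ == _) = false)//.
  by apply/eqP; lia.
rewrite gen_iterSS (IH k j)// (IH (k + 2) (j - 1)); last by lia.
by rewrite (IH (k - 2) (j + 1)) ?mulr0 ?addr0//; lia.
Qed.

(** Even powers vanish at odd distance, so of the extra factor only the diagonal survives here; at
    odd distance only the two jumps do. *)
Lemma gen_iterS_even n m k j : n = k + 2 * j ->
  gi n (2 * m).+1 k = (sg - (up k + down k)) * cell_coef a1 a2 b1 b2 m j.
Proof.
move=> nkj; rewrite gen_iterS (@gen_iter_odd _ _ (k + 1) (j - 1)); last by lia.
rewrite (@gen_iter_odd _ _ (k - 1) j); last by lia.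
by rewrite (gen_iter_even _ nkj) !mulr0 !add0r.
Qed.

Lemma gen_iterS_odd n m k j : n = k + 2 * j + 1 ->
  gi n (2 * m).+1 k =
  up k * cell_coef a1 a2 b1 b2 m j + down k * cell_coef a1 a2 b1 b2 m (j + 1).
Proof.
move=> nkj; rewrite gen_iterS (gen_iter_odd _ nkj) mulr0 addr0.
by congr (_ * _ + _ * _); apply: gen_iter_even; lia.
Qed.

End GenIterCell.

(** * Random time change *)

Section Density.
Context {R : realType} {d : measure_display} {T : measurableType d}.
Variables (P : probability T R) (Y : T -> R) (f : R -> R).
Hypothesis mY : measurable_fun [set: T] Y.
Hypothesis hf : has_density P Y f.
Local Notation mu := (@lebesgue_measure R).

(** The law of Y is dominated by Lebesgue measure, and f agrees almost everywhere with its
    Radon-Nikodym derivative, having the same integrals over measurable sets. *)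
Lemma ge0_integral_has_density (h : R -> R) :
  measurable_fun [set: R] h -> (forall x, 0 <= h x) ->
  (\int[P]_w (h (Y w))%:E = \int[mu]_x (h x * f x)%:E)%E.
Proof.
move=> mh h0; have [mf f0 fP] := hf.
have mY' : @measurable_fun _ _ T (measurableTypeR R) [set: T] Y := mY.
pose mYb := isMeasurableFun.Build _ _ T (measurableTypeR R) Y mY'.
pose X : {mfun T >-> measurableTypeR R} := HB.pack Y mYb.
pose nu := distribution P X.
have nuE A : measurable A -> (nu A = \int[mu]_(x in A) (f x)%:E)%E by exact: fP.
have mfE (A : set R) : measurable_fun A (EFin \o f).
  by apply/measurable_EFinP; exact: measurable_funTS.
have dom : nu `<< mu.
  apply/null_content_dominatesP => A mA A0.
  rewrite nuE//; apply: null_set_integral => //.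
  exact: mfE.
have mhE : measurable_fun [set: R] (EFin \o h) by exact/measurable_EFinP.
transitivity (\int[nu]_x (h x)%:E)%E.
  by rewrite ge0_integral_distribution//= => x; rewrite lee_fin.
have cov := @Radon_Nikodym_SigmaFinite.change_of_variables _ _ _ (distribution P X) mu dom.
rewrite /nu -cov//=.
apply: ae_eq_integral => //.
- apply: emeasurable_funM => //.
  exact: measurable_int (Radon_Nikodym_SigmaFinite.f_integrable dom).
- by apply/measurable_EFinP; exact: measurable_funM.
under [X in ae_eq _ _ _ X]eq_fun do rewrite EFinM.
apply: ae_eqe_mul2l; apply: integral_ae_eq => //.
- exact: Radon_Nikodym_SigmaFinite.f_integrable.
- exact: mfE.
- move=> A _ mA; rewrite -Radon_Nikodym_SigmaFinite.f_integral//.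
  exact: nuE.
Qed.

End Density.

Section BoundedConvergence.
Context {R : realType} {d : measure_display} {T : measurableType d}.
Variable P : probability T R.

Lemma bounded_cvg_Rintegral (u : nat -> T -> R) (v : T -> R) (M : R) :
  (forall n, measurable_fun [set: T] (u n)) ->
  (forall n w, `|u n w| <= M) -> (forall w, u n w @[n --> \oo] --> v w) ->
  \int[P]_w u n w @[n --> \oo] --> \int[P]_w v w.
Proof.
move=> mu_ uM uv.
have mv : measurable_fun [set: T] v.
  by apply: measurable_fun_cvg mu_ _ => w _; exact: uv.
have iM : P.-integrable [set: T] (EFin \o cst M) by exact: finite_measure_integrable_cst.
have mE n : measurable_fun [set: T] (EFin \o u n) by exact/measurable_EFinP.
have mvE : measurable_fun [set: T] (EFin \o v) by exact/measurable_EFinP.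
have uvE : {ae P, forall w, [set: T] w -> (EFin \o u n) w @[n --> \oo] --> (EFin \o v) w}.
  by apply: aeW => w _; apply: cvg_EFin; [exact: nearW|exact: uv].
have uME : {ae P, forall w n, [set: T] w -> (`|(EFin \o u n) w| <= (EFin \o cst M) w)%E}.
  by apply: aeW => w n _; rewrite /= lee_fin.
have [iv _ cv] := dominated_convergence measurableT mE mvE uvE iM uME.
apply: fine_cvg; rewrite fineK//.
exact: integrable_fin_num.
Qed.

End BoundedConvergence.

Section TimeChange.
Context {R : realType} {d : measure_display} {T : measurableType d}.
Variables (P : probability T R) (p : R -> int -> int -> R) (g : int -> int -> R).
Variables (X : R -> T -> int) (S : R -> T -> R) (t : R).
Hypothesis hX : markov_chain P p X.
Hypothesis hg : has_generator p g.
Hypothesis hS : subordinator P S.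
Hypothesis hXS : independent_processes P X S.
Hypothesis t0 : 0 <= t.
Implicit Types (k n : int) (N j : nat).

Let St := S t.

Let mSt : measurable_fun [set: T] St. Proof. exact: (sub_measurable hS). Qed.

Lemma subordinator_ge0 u w : 0 <= u -> 0 <= S u w.
Proof. by move=> u0; rewrite -(sub_0 hS w); exact: (sub_nondecreasing hS). Qed.

Let St0 w : 0 <= St w. Proof. exact: subordinator_ge0. Qed.

Lemma process_sigmaI d' (E : measurableType d') (Z : R -> T -> E) A B :
  process_sigma Z A -> process_sigma Z B -> process_sigma Z (A `&` B).
Proof.
exact: (@measurableI _ (g_sigma_algebraType
  [set A | exists t B, [/\ 0 <= t, measurable B & A = Z t @^-1` B]])).
Qed.

Lemma process_sigma_preimage d' (E : measurableType d') (Z : R -> T -> E) u B :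
  0 <= u -> measurable B -> process_sigma Z (Z u @^-1` B).
Proof. by move=> u0 mB; apply: sub_sigma_algebra; exists u, B. Qed.

Lemma markov_chain_joint u k n : 0 <= u ->
  (P (X u @^-1` [set n] `&` X 0 @^-1` [set k]) =
   P (X 0 @^-1` [set k]) * (p u k n)%:E)%E.
Proof.
move=> u0.
(* Only the times 0 and u matter; the constant tail keeps the sequence nondecreasing. *)
have := mc_markov hX 0%N (t := fun j => if j is 0%N then 0 else u)
  (fun j => if j is 0%N then k else n) (lexx 0).
rewrite !bigcap_mkord !big_ord_recl !big_ord0/= !setIT subr0 => <-.
  by rewrite setIC.
by case.
Qed.

Let mX u n : 0 <= u -> measurable (X u @^-1` [set n]).
Proof.
by move=> u0; rewrite -[X in measurable X]setTI; exact: (mc_measurable hX).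
Qed.

(** On each cell the rounded clock is deterministic, so measurability of X and independence are
    applied at fixed times only. *)
Definition clock_cell N j : set T := St @^-1` `[j%:R / N.+1%:R, j.+1%:R / N.+1%:R[.

(* Strictly above S t, so that right-continuity of the chain applies in the limit. *)
Definition upper_time N w : R := (Num.truncn (St w * N.+1%:R)).+1%:R / N.+1%:R.

Lemma upper_time_clock_cell N j w : clock_cell N j w -> upper_time N w = j.+1%:R / N.+1%:R.
Proof.
rewrite /clock_cell/= in_itv/= ler_pdivrMr// ltr_pdivlMr// => h.
by rewrite /upper_time (truncn_def h).
Qed.

Lemma bigcup_clock_cell N : \bigcup_j clock_cell N j = [set: T].
Proof.
apply/seteqP; split => // w _; exists (Num.truncn (St w * N.+1%:R)) => //.
rewrite /clock_cell/= in_itv/= ler_pdivrMr// ltr_pdivlMr//; apply: truncn_itv.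
by rewrite mulr_ge0.
Qed.

Lemma trivIset_clock_cell N : trivIset [set: nat] (clock_cell N).
Proof.
move=> i j _ _ [w []]; rewrite /clock_cell/= !in_itv/= !ler_pdivrMr// !ltr_pdivlMr//.
by move=> /truncn_def <- /truncn_def <-.
Qed.

Lemma measurable_clock_cell N j : measurable (clock_cell N j).
Proof. by rewrite /clock_cell -[X in measurable X]setTI; exact: mSt. Qed.

Lemma upper_time_gt N w : St w < upper_time N w.
Proof. by rewrite /upper_time ltr_pdivlMr// truncnS_gt. Qed.

Lemma cvg_upper_time w : upper_time N w @[N --> \oo] --> St w.
Proof.
apply: (@squeeze_cvgr _ _ _ _ (cst (St w)) (fun N => St w + N.+1%:R^-1)).
- apply: nearW => N; rewrite ltW ?upper_time_gt//=.
  rewrite /upper_time ler_pdivrMr// mulrDl mulVf// -natr1 lerD2r.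
  by rewrite truncn_le mulr_ge0.
- exact: cvg_cst.
- rewrite -[X in _ --> X](addr0 (St w)); apply: cvgD; first exact: cvg_cst.
  exact: (@cvg_harmonic R).
Qed.

Lemma measurable_comp_upper_time N d' (E : measurableType d') (h : R -> E) :
  measurable_fun [set: T] (fun w => h (upper_time N w)).
Proof.
rewrite -(bigcup_clock_cell N); apply/measurable_fun_bigcup => j; first exact: measurable_clock_cell.
apply: (eq_measurable_fun (cst (h (j.+1%:R / N.+1%:R)))) => [w|].
  by rewrite inE => wj; rewrite (upper_time_clock_cell wj).
exact: measurable_cst.
Qed.

Let A k n := (fun w => X (St w) w) @^-1` [set n] `&` X 0 @^-1` [set k].
Let A_ k n N := (fun w => X (upper_time N w) w) @^-1` [set n] `&` X 0 @^-1` [set k].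

Let A_bigcup k n N : A_ k n N =
  \bigcup_j (X (j.+1%:R / N.+1%:R) @^-1` [set n] `&` X 0 @^-1` [set k] `&` clock_cell N j).
Proof.
apply/seteqP; split => w.
  move=> [Xn X0k]; have : [set: T] w by [].
  rewrite -(bigcup_clock_cell N) => -[j _ wj]; exists j => //; split => //; split => //.
  by rewrite /= -(upper_time_clock_cell wj).
move=> [j _ [[Xn X0k] wj]]; split => //.
by rewrite /= (upper_time_clock_cell wj).
Qed.

Let mA_ k n N : measurable (A_ k n N).
Proof.
rewrite A_bigcup; apply: bigcup_measurable => j _.
apply: measurableI; last exact: measurable_clock_cell.
by apply: measurableI; apply: mX => //; rewrite divr_ge0.
Qed.

(** Sum over the cells: independence separates chain from clock, the Markov property evaluates the
    chain part, and the sum reassembles into an integral. *)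
Lemma prob_upper_time k n N : (P (A_ k n N) = P (X 0 @^-1` [set k]) *
  \int[P]_w (tf_ext p k n (upper_time N w))%:E)%E.
Proof.
have tf := mc_transition hX.
have [q qE] : exists q, P (X 0 @^-1` [set k]) = q%:E.
  by exists (fine (P (X 0 @^-1` [set k]))); rewrite fineK// fin_num_measure//; exact: mX.
rewrite qE A_bigcup measure_semi_bigcup; last 3 first.
- move=> j; apply: measurableI; last exact: measurable_clock_cell.
  by apply: measurableI; apply: mX => //; rewrite divr_ge0.
- by apply: trivIset_setIl; exact: trivIset_clock_cell.
- by rewrite -A_bigcup; exact: mA_.
rewrite -[X in integral _ X _](bigcup_clock_cell N) ge0_integral_bigcup//; last 4 first.
- exact: measurable_clock_cell.
- rewrite bigcup_clock_cell; apply/measurable_EFinP.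
  exact: (measurable_comp_upper_time N (tf_ext p k n)).
- by move=> w _; rewrite lee_fin; exact: (tf_ext_ge0 tf).
- exact: trivIset_clock_cell.
rewrite -nneseriesZl//; last first.
  by move=> j _; apply: integral_ge0 => w _; rewrite lee_fin; exact: (tf_ext_ge0 tf).
apply: eq_eseriesr => j _.
have j0 : 0 <= j.+1%:R / N.+1%:R :> R by rewrite divr_ge0.
transitivity (P (X (j.+1%:R / N.+1%:R) @^-1` [set n] `&` X 0 @^-1` [set k]) * P (clock_cell N j))%E.
  apply: hXS; last exact: process_sigma_preimage.
  by apply: process_sigmaI; exact: process_sigma_preimage.
rewrite markov_chain_joint// qE -muleA; congr (_ * _)%E.
transitivity (\int[P]_(w in clock_cell N j) (p (j.+1%:R / N.+1%:R) k n)%:E)%E.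
  by rewrite integral_cst//; exact: measurable_clock_cell.
by apply: eq_integral => w; rewrite inE => wj; rewrite (upper_time_clock_cell wj) tf_extE.
Qed.

(** A right-continuous integer-valued path is constant shortly after [St w], where the rounded clock
    eventually lies; the indicators are then equal. *)
Let cvg_indic k n w : \1_(A_ k n N) w @[N --> \oo] --> (\1_(A k n) w : R).
Proof.
apply: cvg_near_cst.
have := mc_right_continuous hX w (St0 w) => hrc.
have /cvgrPdist_lt cu := @cvg_upper_time w.
case: hrc => e /= e0 he.
have [M _ hM] := cu e e0.
exists M => // N MN; rewrite /A_ /A !indicE; congr (_%:R); congr nat_of_bool.
have XE : X (upper_time N w) w = X (St w) w.
  by apply: he; [exact: hM|exact: upper_time_gt].
by apply/idP/idP; rewrite !inE /= XE.
Qed.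

Lemma measurable_time_change k n : measurable (A k n).
Proof.
have mi : measurable_fun [set: T] (\1_(A k n) : T -> R).
  apply: (measurable_fun_cvg (h := fun N => \1_(A_ k n N))).
    by move=> N; apply: measurable_indic; exact: mA_.
  by move=> w _; exact: cvg_indic.
have -> : A k n = (\1_(A k n) : T -> R) @^-1` [set 1].
  apply/seteqP; split => w /=; rewrite indicE.
    by move=> /mem_set ->.
  by case: (boolP (w \in A k n)) => [/set_mem//|_ /eqP]; rewrite eq_sym oner_eq0.
by rewrite -[X in measurable X]setTI; apply: mi.
Qed.

(** Both sides of [prob_upper_time] converge by bounded convergence: the indicators by
    right-continuity of paths, the integrals by continuity of p. *)
Lemma prob_time_change k n :
  (P ((fun w => X (S t w) w) @^-1` [set n] `&` X 0 @^-1` [set k]) =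
   P (X 0 @^-1` [set k]) * (\int[P]_w tf_ext p k n (S t w))%:E)%E.
Proof.
have tf := mc_transition hX.
have mAk : measurable (A k n) := measurable_time_change k n.
have fP B : measurable B -> P B \is a fin_num by move=> mB; exact: fin_num_measure.
have c1 : fine (P (A_ k n N)) @[N --> \oo] --> fine (P (A k n)).
  have := @bounded_cvg_Rintegral _ _ _ P (fun N => \1_(A_ k n N)) _ 1 _ _ (@cvg_indic k n).
  move=> /(_ _ _)/wrap[].
  - by move=> N; apply: measurable_indic; exact: mA_.
  - by move=> N w; rewrite indicE ger0_norm// lern1; case: (_ \in _).
  rewrite /Rintegral integral_indic// setIT.
  by under eq_fun do rewrite integral_indic ?setIT//.
have c2 : \int[P]_w tf_ext p k n (upper_time N w) @[N --> \oo] -->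
    \int[P]_w tf_ext p k n (St w).
  apply: (@bounded_cvg_Rintegral _ _ _ P _ _ 1).
  - by move=> N; exact: measurable_comp_upper_time.
  - by move=> N w; rewrite ger0_norm ?(tf_ext_ge0 tf)// (tf_ext_le1 tf).
  - move=> w; apply: (cvg_comp _ _ (@cvg_upper_time w)).
    exact: (continuous_tf_ext tf hg).
have mX0 : measurable (X 0 @^-1` [set k]) by exact: mX.
have c3 : fine (P (A_ k n N)) @[N --> \oo] -->
    fine (P (X 0 @^-1` [set k])) * \int[P]_w tf_ext p k n (St w).
  apply: cvg_trans (cvgM (cvg_cst (fine (P (X 0 @^-1` [set k])))) c2).
  apply: near_eq_cvg; apply: nearW => N.
  rewrite /= prob_upper_time fineM//; first exact: fP.
  apply: integrable_fin_num => //.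
  apply: (@le_integrable _ _ _ _ _ _ _ (EFin \o cst 1)) => //.
  - by apply/measurable_EFinP; exact: (measurable_comp_upper_time N (tf_ext p k n)).
  - by move=> w _ /=; rewrite lee_fin ger0_norm ?(tf_ext_ge0 tf)// normr1 (tf_ext_le1 tf).
  - exact: finite_measure_integrable_cst.
have := cvg_unique _ c1 c3 => /(_ (@Rhausdorff R)) h.
by rewrite -[LHS]fineK ?fP// h EFinM fineK ?fP.
Qed.

End TimeChange.

(** * Moments of the stable subordinator *)

Section MomentSeries.
Context {R : realType} {d : measure_display} {T : measurableType d}.
Variables (P : probability T R) (Y : T -> R) (s mu : R).
Hypothesis mY : measurable_fun [set: T] Y.
Hypothesis Y0 : forall w, 0 <= Y w.
Hypotheses (s0 : 0 < s) (mu0 : 0 <= mu).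
Implicit Types (c : nat -> R) (C : R) (N m i : nat).

Let lam := s + mu.
Let lam0 : 0 < lam. Proof. by rewrite ltr_pwDl. Qed.
Let lm m := laplace_moment P Y m lam.

Lemma exp_partial_sum_le N (x : R) : 0 <= x ->
  \sum_(i < N) x ^+ i / i`!%:R <= expR x.
Proof.
move=> x0; have := @nondecreasing_cvgn_le _ (series (exp_coeff x)) _ _ N.
rewrite /series/= big_mkord; apply; last exact: is_cvg_series_exp_coeff.
by apply/nondecreasing_series => n _ _; rewrite /exp_coeff/= divr_ge0// exprn_ge0.
Qed.

Definition moment_partial c N w :=
  (\sum_(i < N) Y w ^+ i / i`!%:R * c i) * expR (- lam * Y w).

Lemma moment_partialE c N w :
  moment_partial c N w = \sum_(i < N) c i / i`!%:R * laplace_moment_fun Y i lam w.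
Proof.
rewrite /moment_partial mulr_suml; apply: eq_bigr => i _.
by rewrite /laplace_moment_fun; ring.
Qed.

Lemma integrable_moment_partial c N :
  P.-integrable [set: T] (EFin \o moment_partial c N) /\
  \int[P]_w moment_partial c N w = \sum_(i < N) c i / i`!%:R * lm i.
Proof.
have -> : moment_partial c N = fun w => \sum_(i < N) c i / i`!%:R * laplace_moment_fun Y i lam w.
  by apply/funext => w; exact: moment_partialE.
elim: N => [|N [iN IH]].
  split; last by under eq_Rintegral do rewrite big_ord0; rewrite big_ord0 /Rintegral integral0_eq.
  rewrite (_ : _ \o _ = cst 0%E); first exact: integrable0.
  by apply/funext => w /=; rewrite big_ord0.
have ilm := @integrable_laplace_moment_fun _ _ _ P Y mY Y0 N lam lam0.
have iZ : P.-integrable [set: T] (EFin \o (fun w => c N / N`!%:R * laplace_moment_fun Y N lam w)).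
  rewrite (_ : _ \o _ = fun w => ((c N / N`!%:R)%:E * (laplace_moment_fun Y N lam w)%:E)%E).
    exact: integrableZl.
  by apply/funext.
split.
  rewrite (_ : _ \o _ = (EFin \o (fun w => \sum_(i < N) c i / i`!%:R * laplace_moment_fun Y i lam w)%R)
    \+ (EFin \o (fun w => c N / N`!%:R * laplace_moment_fun Y N lam w)%R))%E.
    exact: integrableD.
  by apply/funext => w /=; rewrite big_ord_recr.
under eq_Rintegral do rewrite big_ord_recr/=.
by rewrite RintegralD// IH RintegralZl// big_ord_recr.
Qed.

Lemma moment_term_le c C i w : (forall i, `|c i| <= C * s ^+ i) ->
  `|Y w ^+ i / i`!%:R * c i| <= C * ((s * Y w) ^+ i / i`!%:R).
Proof.
move=> cC; rewrite normrM ger0_norm; last by rewrite divr_ge0// exprn_ge0.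
have -> : C * ((s * Y w) ^+ i / i`!%:R) = Y w ^+ i / i`!%:R * (C * s ^+ i).
  by rewrite exprMn; ring.
by rewrite ler_wpM2l// divr_ge0// exprn_ge0.
Qed.

(** The sum is at most [C * expR (s * Y w)], which [expR (- lam * Y w)] absorbs since [lam >= s]. *)
Lemma moment_partial_le c C N w : (forall i, `|c i| <= C * s ^+ i) ->
  `|moment_partial c N w| <= C.
Proof.
move=> cC; have C0 : 0 <= C by have := cC 0%N; rewrite expr0 mulr1; exact: le_trans.
rewrite /moment_partial normrM (ger0_norm (expR_ge0 _)) mulNr expRN ler_pdivrMr ?expR_gt0//.
apply: le_trans (ler_norm_sum _ _ _) _.
apply: (@le_trans _ _ (C * \sum_(i < N) (s * Y w) ^+ i / i`!%:R)).
  by rewrite mulr_sumr; apply: ler_sum => i _; exact: moment_term_le.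
rewrite ler_wpM2l//; apply: le_trans (exp_partial_sum_le _ _) _.
  by rewrite mulr_ge0// ltW.
by rewrite ler_expR ler_wpM2r// lerDl.
Qed.

Lemma moment_series_lim c C (G : T -> R) : (forall i, `|c i| <= C * s ^+ i) ->
  (forall w, \sum_(i < N) Y w ^+ i / i`!%:R * c i @[N --> \oo] --> G w) ->
  \sum_(i < N) c i / i`!%:R * lm i @[N --> \oo] --> \int[P]_w (G w * expR (- lam * Y w)).
Proof.
move=> cC cG.
have -> : (fun N => \sum_(i < N) c i / i`!%:R * lm i) = fun N => \int[P]_w moment_partial c N w.
  by apply/funext => N; rewrite (integrable_moment_partial c N).2.
apply: (@bounded_cvg_Rintegral _ _ _ P _ _ C).
- by move=> N; have [/(measurable_int P)/measurable_EFinP] := integrable_moment_partial c N.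
- by move=> N w; exact: moment_partial_le.
- by move=> w; apply: cvgM; [exact: cG|exact: cvg_cst].
Qed.

(** For coefficients whose pointwise sum has no prior identification, such as one of the two sums of
    an off-diagonal formula. *)
Lemma moment_series_cvg c C : (forall i, `|c i| <= C * s ^+ i) ->
  cvgn (fun N => \sum_(i < N) c i / i`!%:R * lm i).
Proof.
move=> cC; have C0 : 0 <= C by have := cC 0%N; rewrite expr0 mulr1; exact: le_trans.
pose G w := limn (fun N => \sum_(i < N) Y w ^+ i / i`!%:R * c i).
apply/cvg_ex; eexists; apply: (@moment_series_lim c C G cC) => w.
suff : cvgn (series (fun i => Y w ^+ i / i`!%:R * c i)).
  by rewrite /G /series/=; under eq_fun do rewrite big_mkord.
apply: normed_cvg; apply: (@series_le_cvg _ _ (fun i => C * exp_coeff (s * Y w) i)).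
- by move=> i; rewrite normr_ge0.
- by move=> i; rewrite mulr_ge0// divr_ge0// exprn_ge0// mulr_ge0// ltW.
- by move=> i; exact: moment_term_le.
- rewrite /series/=; under eq_fun do rewrite -mulr_sumr.
  by apply: is_cvgM; [exact: is_cvg_cst|exact: is_cvg_series_exp_coeff].
Qed.

End MomentSeries.

Section SumHelpers.
Context {R : realType}.
Implicit Types (u F : nat -> R).

Lemma sum_ord_double F N : \sum_(i < (2 * N)%N) F i = \sum_(m < N) (F (2 * m)%N + F (2 * m).+1).
Proof.
elim: N => [|N IH]; first by rewrite muln0 !big_ord0.
by rewrite mulnS add2n !big_ord_recr/= IH addrA.
Qed.

Lemma cvg_double : (2 * N)%N @[N --> \oo] --> \oo.
Proof.
move=> A [M _ MA]; exists M => // N /= MN; apply: MA => /=.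
by rewrite (leq_trans MN)// leq_pmull.
Qed.

Lemma sums_from_series m u l : (forall n, (n < m)%N -> u n = 0) ->
  \sum_(n < N) u n @[N --> \oo] --> l -> sums_from m u l.
Proof.
move=> u0; apply: cvg_trans; apply: near_eq_cvg; near=> N.
have mN : (m <= N)%N by near: N; exists m.
rewrite -(big_mkord xpredT) (@big_cat_nat _ _ _ m)//= big_nat big1 ?add0r//.
Unshelve. all: by end_near. Qed.

End SumHelpers.

(** * The four transition probabilities in both cases *)

Section TransitionProbabilities.
Context {R : realType}.
Variables (a1 a2 b1 b2 nu mu : R).
Hypotheses (ha1 : 0 < a1) (ha2 : 0 < a2) (hb1 : 0 < b1) (hb2 : 0 < b2).
Hypotheses (hnu0 : 0 < nu) (hmu : 0 <= mu).
Variables (d0 : measure_display) (T0 : measurableType d0) (P0 : probability T0 R).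
Variables (S0 : R -> T0 -> R) (f : R -> R -> R).
Hypothesis hS0 : stable_subordinator P0 nu S0.
Hypothesis hf : forall t : R, 0 < t -> has_density P0 (S0 t) (f t).
Variables (d : measure_display) (T : measurableType d) (P : probability T R).
Variables (p : R -> int -> int -> R) (X : R -> T -> int) (S : R -> T -> R).
Hypothesis hX : markov_chain P p X.
Hypothesis hgen : has_generator p (chain_gen a1 a2 b1 b2).
Hypothesis hS : tempered_stable_subordinator P nu mu f S.
Hypothesis hXS : independent_processes P X S.
Variable t : R.
Hypothesis t0 : 0 <= t.
Implicit Types (k n j r s : int) (m i N : nat).

Let up := parity_rate a1 b1.
Let down := parity_rate a2 b2.
Let sg : R := (a1 + a2 + b1 + b2) / 2.
Let lam := sg + mu.
Let tf := mc_transition hX.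
Let Y := S0 t.

Let sg0 : 0 < sg. Proof. by rewrite divr_gt0// !addr_gt0. Qed.
Let lam0 : 0 < lam. Proof. by rewrite ltr_pwDl. Qed.

Let mY : measurable_fun [set: T0] Y.
Proof. exact: (sub_measurable (stable_sub hS0)). Qed.

Let Y0 w : 0 <= Y w. Proof. exact: (subordinator_ge0 (stable_sub hS0)). Qed.

Let lm m := laplace_moment P0 Y m lam.

(** Taken under the untempered clock, whose Laplace transform is known, with the tempering moved
    into the integrand. *)
Definition tempered_mean k n := \int[P0]_w (tf_ext p k n (Y w) * expR (- mu * Y w)).

Let up_down_le k : up k + down k <= 2 * sg.
Proof.
have -> : 2 * sg = a1 + a2 + b1 + b2 by rewrite /sg mulrC divfK.
have := ha1; have := ha2; have := hb1; have := hb2.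
by rewrite /up /down /parity_rate; case: ifP => _; lra.
Qed.

Let up0 k : 0 <= up k. Proof. by rewrite /up /parity_rate; case: ifP => _; exact: ltW. Qed.
Let down0 k : 0 <= down k. Proof. by rewrite /down /parity_rate; case: ifP => _; exact: ltW. Qed.

(** The factor 2 arises at odd distance, where [up k + down k] is only bounded by [2 * sg]; at even
    distance 1 would do. *)
Lemma gen_iter_le n k i : `|gen_iter up down sg n i k| <= 2 * sg ^+ i.
Proof.
have db m j : `|cell_coef a1 a2 b1 b2 m j| <= sg ^+ (2 * m).
  by have /andP[h1 h2] := cell_coef_bounds ha1 ha2 hb1 hb2 m j; rewrite ger0_norm.
have sgX l : 0 <= sg ^+ l by rewrite exprn_ge0// ltW.
have le2 (l : nat) (x : R) : x <= sg ^+ l -> x <= 2 * sg ^+ l.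
  by have := sgX l; lra.
have [j [nk|nk]] : exists j, n = k + 2 * j \/ n = k + 2 * j + 1.
  by exists ((n - k) %/ 2)%Z; lia.
- have [m [->|->]] : exists m, i = (2 * m)%N \/ i = (2 * m).+1 by exists (i./2); lia.
    by rewrite (gen_iter_even _ _ _ _ _ nk) le2.
  rewrite (gen_iterS_even _ _ _ _ _ nk) le2// normrM exprS ler_pM//.
  rewrite -/sg -/(up k) -/(down k).
  by rewrite ler_norml; have := up_down_le k; have := up0 k; have := down0 k; lra.
- have [m [->|->]] : exists m, i = (2 * m)%N \/ i = (2 * m).+1 by exists (i./2); lia.
    by rewrite (gen_iter_odd _ _ _ _ _ nk) normr0 mulr_ge0.
  rewrite (gen_iterS_odd _ _ _ _ _ nk).
  apply: (@le_trans _ _ (up k * sg ^+ (2 * m) + down k * sg ^+ (2 * m))).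
    apply: le_trans (ler_normD _ _) _.
    by rewrite !normrM (ger0_norm (up0 k)) (ger0_norm (down0 k)) lerD// ler_wpM2l.
  by rewrite -mulrDl exprS mulrA ler_wpM2r.
Qed.

Lemma cvg_tempered_mean n k :
  \sum_(i < N) gen_iter up down sg n i k / i`!%:R * lm i @[N --> \oo] --> tempered_mean k n.
Proof.
have h := @moment_series_lim _ _ _ P0 Y sg mu mY Y0 sg0 hmu
  (fun i => gen_iter up down sg n i k) 2 (fun w => expR (sg * Y w) * p (Y w) k n)
  (gen_iter_le n k).
(* The factor [expR (sg * Y w)] belongs to the series of p; against [- (sg + mu)] it leaves the
   tempering. *)
rewrite (_ : tempered_mean k n = \int[P0]_w (expR (sg * Y w) * p (Y w) k n * expR (- (sg + mu) * Y w))).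
  by apply: h => w; exact: (@tf_series _ p up down sg tf hgen up0 down0 up_down_le n k (Y w) (Y0 w)).
apply: eq_Rintegral => w _; rewrite tf_extE// mulrAC -expRD mulrC; congr (expR _ * _).
by ring.
Qed.

(** Along partial sums of even length, the powers [2m] and [2m + 1] share one cell coefficient;
    their pairing is the brace in the diagonal formulas. *)
Lemma cvg_tempered_mean_even k n j : n = k + 2 * j ->
  \sum_(m < N) cell_coef a1 a2 b1 b2 m j *
    (lm (2 * m) / (2 * m)`!%:R + (sg - (up k + down k)) * (lm (2 * m).+1 / (2 * m).+1`!%:R))
  @[N --> \oo] --> tempered_mean k n.
Proof.
move=> nk; apply: cvg_trans (cvg_comp _ _ cvg_double (@cvg_tempered_mean n k)).
apply: near_eq_cvg; apply: nearW => N.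
apply: (etrans (sum_ord_double (fun i => gen_iter up down sg n i k / i`!%:R * lm i) N)); apply: eq_bigr => m _.
rewrite (gen_iter_even _ _ _ _ _ nk) (gen_iterS_even _ _ _ _ _ nk).
by rewrite -/sg -/(up k) -/(down k); ring.
Qed.

Definition odd_moment_sum j :=
  limn (fun N => \sum_(m < N) cell_coef a1 a2 b1 b2 m j * (lm (2 * m).+1 / (2 * m).+1`!%:R)).

Lemma cvg_odd_moment_sum j :
  \sum_(m < N) cell_coef a1 a2 b1 b2 m j * (lm (2 * m).+1 / (2 * m).+1`!%:R)
  @[N --> \oo] --> odd_moment_sum j.
Proof.
(* Placing the coefficients at odd indices costs one power of [sg], hence the constant [sg^-1]. *)
pose c i := if odd i then cell_coef a1 a2 b1 b2 i./2 j else 0.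
have cC i : `|c i| <= sg^-1 * sg ^+ i.
  rewrite /c; case: ifPn => io; last by rewrite normr0 mulr_ge0// ?invr_ge0 ?exprn_ge0// ltW.
  have /andP[h1 h2] := cell_coef_bounds ha1 ha2 hb1 hb2 i./2 j.
  rewrite ger0_norm// (le_trans h2)// -{2}(odd_double_half i) io exprS mulKf ?gt_eqF//.
  by rewrite mul2n.
have /cvg_ex[/= l cl] := @moment_series_cvg _ _ _ P0 Y sg mu mY Y0 sg0 hmu c _ cC.
suff cA : \sum_(m < N) cell_coef a1 a2 b1 b2 m j * (lm (2 * m).+1 / (2 * m).+1`!%:R)
  @[N --> \oo] --> l by rewrite /odd_moment_sum (cvg_lim _ cA).
apply: cvg_trans (cvg_comp _ _ cvg_double cl).
apply: near_eq_cvg; apply: nearW => N.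
apply: (etrans (sum_ord_double (fun i => c i / i`!%:R * lm i) N)); apply: eq_bigr => m _.
rewrite /c /= oddM/= mul0r mul0r add0r mul2n uphalf_double.
by ring.
Qed.

Lemma tempered_mean_odd k n j : n = k + 2 * j + 1 ->
  tempered_mean k n = up k * odd_moment_sum j + down k * odd_moment_sum (j + 1).
Proof.
move=> nk.
have c1 := cvg_comp _ _ cvg_double (@cvg_tempered_mean n k).
have c2 : up k * (\sum_(m < N) cell_coef a1 a2 b1 b2 m j * (lm (2 * m).+1 / (2 * m).+1`!%:R))
  + down k * (\sum_(m < N) cell_coef a1 a2 b1 b2 m (j + 1) * (lm (2 * m).+1 / (2 * m).+1`!%:R))
  @[N --> \oo] --> up k * odd_moment_sum j + down k * odd_moment_sum (j + 1).
  by apply: cvgD; (apply: cvgM; [exact: cvg_cst|exact: cvg_odd_moment_sum]).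
have c3 : ((fun N => \sum_(i < N) gen_iter up down sg n i k / i`!%:R * lm i) \o muln 2%N) x
    @[x --> \oo] --> up k * odd_moment_sum j + down k * odd_moment_sum (j + 1).
  apply: cvg_trans c2; apply: near_eq_cvg; apply: nearW => N.
  rewrite [RHS](sum_ord_double (fun i => gen_iter up down sg n i k / i`!%:R * lm i) N).
  rewrite !mulr_sumr -big_split; apply: eq_bigr => m _.
  rewrite (gen_iter_odd _ _ _ _ _ nk) (gen_iterS_odd _ _ _ _ _ nk) -/(up k) -/(down k).
  by rewrite -[LHS]/(_ + _); ring.
by apply: (norm_cvg_unique c1 c3).
Qed.

Lemma wright_V_laplace_moment m :
  wright_V nu (1 - m%:R) (- t * lam `^ nu) = (-1) ^+ m * lam ^+ m * lm m.
Proof.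
have lapl (l : R) : 0 < l ->
    (\int[P0]_w (expR (- l * Y w))%:E = (expR (- t * l `^ nu))%:E)%E.
  move=> l0; have := stable_laplace hS0 (g := - l) (t := t) _ t0.
  rewrite oppr_le0 ltW// => /(_ isT).
  by rewrite unlock normrN gtr0_norm// mulNr -mulrN mulrC => ->; rewrite mulNr.
rewrite /lm (laplace_moment_wright_V hnu0 mY Y0 lapl m lam0).
rewrite mulrA mulrACA -expr2 sqrr_sign mul1r mulfV ?mul1r//.
by rewrite expf_neq0// gt_eqF.
Qed.

Lemma integral_time_change k n :
  \int[P]_w tf_ext p k n (S t w) = expR (mu `^ nu * t) * tempered_mean k n.
Proof.
have [hSs hSd] := hS.
have ip : P0.-integrable [set: T0] (EFin \o (fun w => tf_ext p k n (Y w) * expR (- mu * Y w))).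
  apply: (@le_integrable _ _ _ _ _ _ _ (EFin \o cst 1)) => //.
  - apply/measurable_EFinP; apply: measurable_funM.
      apply: measurableT_comp => //; apply: continuous_measurable_fun.
      exact: (continuous_tf_ext tf hgen).
    by apply: measurableT_comp => //; exact: measurable_funM.
  - move=> w _ /=; rewrite lee_fin normr1 normrM !ger0_norm ?expR_ge0 ?(tf_ext_ge0 tf)//.
    rewrite -[leRHS]mulr1 ler_pM ?expR_ge0 ?(tf_ext_ge0 tf) ?(tf_ext_le1 tf)//.
    by rewrite expR_le1 mulNr oppr_le0 mulr_ge0.
  - exact: finite_measure_integrable_cst.
rewrite -RintegralZl//.
(* Densities exist only for positive times; at time 0 both clocks are 0. *)
move: t0; rewrite le_eqVlt => /predU1P[tE|tpos].
  rewrite /Y -tE mulr0 expR0.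
  under eq_Rintegral do rewrite (sub_0 hSs).
  under [RHS]eq_Rintegral do rewrite (sub_0 (stable_sub hS0)) mulr0 expR0 mulr1 mul1r.
  by rewrite /Rintegral !integral_cst//= !probability_setT.
rewrite /Rintegral; congr fine.
have mtf : measurable_fun [set: R] (tf_ext p k n).
  by apply: continuous_measurable_fun; exact: (continuous_tf_ext tf hgen).
have me : measurable_fun [set: R] (fun x => expR (- mu * x + mu `^ nu * t)).
  apply: measurableT_comp => //; apply: measurable_funD; last exact: measurable_cst.
  exact: measurable_funM.
rewrite (ge0_integral_has_density (sub_measurable hSs t0) (hSd _ tpos) mtf); last first.
  by move=> x; exact: (tf_ext_ge0 tf).
transitivity (\int[P0]_w (tf_ext p k n (Y w) * expR (- mu * Y w + mu `^ nu * t))%:E)%E; last first.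
  by apply: eq_integral => w _; rewrite expRD; congr (_%:E); ring.
rewrite (ge0_integral_has_density mY (hf tpos)
  (h := fun x => tf_ext p k n x * expR (- mu * x + mu `^ nu * t))).
- by apply: eq_integral => x _; rewrite mulrA.
- exact: measurable_funM.
- by move=> x; rewrite mulr_ge0 ?expR_ge0// (tf_ext_ge0 tf).
Qed.

Lemma time_change0 k : time_change X S 0 @^-1` [set k] = X 0 @^-1` [set k].
Proof.
have [hSs _] := hS.
by apply/seteqP; split => w; rewrite /time_change /preimage/= (sub_0 hSs).
Qed.

Lemma cond_prob_time_change k n : P (time_change X S 0 @^-1` [set k]) != 0%E ->
  cond_prob P (time_change X S t @^-1` [set n]) (time_change X S 0 @^-1` [set k]) =
  expR (mu `^ nu * t) * tempered_mean k n.
Proof.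
have [hSs _] := hS.
rewrite time_change0 => Pk; rewrite -integral_time_change /cond_prob.
have mX0 : measurable (X 0 @^-1` [set k]).
  by rewrite -[X in measurable X]setTI; exact: (mc_measurable hX).
have fX0 : P (X 0 @^-1` [set k]) \is a fin_num by exact: fin_num_measure.
rewrite (prob_time_change hX hgen hSs hXS t0) fineM//= mulrAC mulfV ?mul1r//.
by rewrite fine_eq0.
Qed.


Lemma wright_V_even m :
  wright_V nu (1 - (2 * m)%:R) (- t * lam `^ nu) = lam ^+ (2 * m) * lm (2 * m).
Proof. by rewrite wright_V_laplace_moment exprM sqrrN !expr1n mul1r. Qed.

(** Because [- 2m = 1 - (2m + 1)], this is a moment of odd order; its sign explains the minus signs
    in the formulas. *)
Lemma wright_V_odd m :
  wright_V nu (- (2 * m)%:R) (- t * lam `^ nu) = - (lam * lam ^+ (2 * m) * lm (2 * m).+1).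
Proof.
have -> : - (2 * m)%:R = 1 - (2 * m).+1%:R :> R by rewrite -[in RHS]natr1; ring.
by rewrite wright_V_laplace_moment exprS exprM sqrrN !expr1n mulr1 exprS mulN1r mulNr.
Qed.

Lemma sums_from_even (u : nat -> R) k n j : n = k + 2 * j ->
  (forall m, u m = cell_coef a1 a2 b1 b2 m j *
    (lm (2 * m) / (2 * m)`!%:R + (sg - (up k + down k)) * (lm (2 * m).+1 / (2 * m).+1`!%:R))) ->
  sums_from `|j|%N u (tempered_mean k n).
Proof.
move=> nk uE; apply: sums_from_series => [m mj|].
  by rewrite uE cell_coef_small ?mul0r.
by under eq_fun do (under eq_bigr do rewrite uE); exact: cvg_tempered_mean_even.
Qed.

Lemma sums_from_odd (u : nat -> R) j x :
  (forall m, u m = x * (cell_coef a1 a2 b1 b2 m j * (lm (2 * m).+1 / (2 * m).+1`!%:R))) ->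
  sums_from `|j|%N u (x * odd_moment_sum j).
Proof.
move=> uE; apply: sums_from_series => [m mj|].
  by rewrite uE cell_coef_small ?mul0r ?mulr0.
under eq_fun do (under eq_bigr do rewrite uE).
under eq_fun do rewrite -mulr_sumr.
by apply: cvgM; [exact: cvg_cst|exact: cvg_odd_moment_sum].
Qed.

Let c := (b1 + b2 - a1 - a2) / (a1 + a2 + b1 + b2 + 2 * mu).

Let cE : c = (b1 + b2 - a1 - a2) / 2 / lam.
Proof.
have l2 : a1 + a2 + b1 + b2 + 2 * mu = 2 * lam by rewrite /lam /sg; field.
by rewrite /c l2; field; rewrite gt_eqF.
Qed.

(** [c] is [delta / 2] divided by [lam]: the numerators complete [theta_coef] to a cell coefficient,
    the denominators meet the powers of [lam] in the Fox-Wright values. *)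
Lemma theta_term e s r m : a1 + a2 != b1 + b2 -> e = s - r ->
  c ^+ (2 * m) * (a1 * b1 / (a2 * b2)) ^ e * theta_coef a1 a2 b1 b2 r s m =
  (lam ^+ (2 * m))^-1 * cell_coef a1 a2 b1 b2 m e.
Proof.
move=> ab ->; rewrite -theta_coefE// cE exprMn exprVn.
by ring.
Qed.

Lemma theta_term_swap e s r m : a1 + a2 != b1 + b2 -> e = s - r ->
  (- c) ^+ (2 * m) * (a1 * b1 / (a2 * b2)) ^ e * theta_coef b1 b2 a1 a2 r s m =
  (lam ^+ (2 * m))^-1 * cell_coef a1 a2 b1 b2 m e.
Proof.
move=> ab ->; rewrite -cell_coef_swap -theta_coefE//; last by rewrite eq_sym.
have -> : - c = (a1 + a2 - b1 - b2) / 2 / lam by rewrite cE; ring.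
rewrite exprMn exprVn [b1 * a1]mulrC [b2 * a2]mulrC.
by ring.
Qed.

Lemma eta_term e s r m : a1 + a2 = b1 + b2 -> e = s - r ->
  (a1 * b1 / (a2 * b2)) ^ e * eta_coef a1 a2 b1 b2 r s m = cell_coef a1 a2 b1 b2 m e.
Proof. by move=> ab ->; rewrite -eta_coefE. Qed.

Lemma eta_term_swap e s r m : a1 + a2 = b1 + b2 -> e = s - r ->
  (a1 * b1 / (a2 * b2)) ^ e * eta_coef b1 b2 a1 a2 r s m = cell_coef a1 a2 b1 b2 m e.
Proof.
move=> ab ->; rewrite -cell_coef_swap -eta_coefE//.
by rewrite [b1 * a1]mulrC [b2 * a2]mulrC.
Qed.

Let up_even r : up (2 * r) = a1. Proof. by rewrite /up /parity_rate dvdz_mulr. Qed.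
Let down_even r : down (2 * r) = a2. Proof. by rewrite /down /parity_rate dvdz_mulr. Qed.
Let up_odd r : up (2 * r + 1) = b1.
Proof. by rewrite /up /parity_rate ifF//; apply/negbTE; rewrite rpredDl ?dvdz_mulr. Qed.
Let down_odd r : down (2 * r + 1) = b2.
Proof. by rewrite /down /parity_rate ifF//; apply/negbTE; rewrite rpredDl ?dvdz_mulr. Qed.

Let z := - t * lam `^ nu.
Let E k n := expR (mu `^ nu * t) * tempered_mean k n.

Let lamX m : lam ^+ m != 0. Proof. by rewrite expf_neq0// gt_eqF. Qed.
Let lamn : lam != 0. Proof. by rewrite gt_eqF. Qed.

(** Here x is the diagonal entry of the shifted generator divided by [lam]: [c] from even sites,
    [- c] from odd ones, 0 for equal total rates. *)
Let diag_sum k n j x (u : nat -> R) : n = k + 2 * j -> x * lam = sg - (up k + down k) ->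
  (forall m, u m = (lam ^+ (2 * m))^-1 * cell_coef a1 a2 b1 b2 m j *
    ((2 * m)`!%:R^-1 * wright_V nu (1 - (2 * m)%:R) z
     - x * ((2 * m).+1`!%:R^-1 * wright_V nu (- (2 * m)%:R) z))) ->
  sums_from `|j|%N u (tempered_mean k n).
Proof.
move=> nk xE uE; apply: (sums_from_even nk) => m.
rewrite uE wright_V_even wright_V_odd -xE.
move: (lamX (2 * m)) ((2 * m)`!%:R^-1) ((2 * m).+1`!%:R^-1) => + y1 y2.
by move: (lam ^+ (2 * m)) => L Ln; field.
Qed.

(** x collects the normalisation outside the even powers: 1 in the unequal case, [lam^-1] in the
    equal one. *)
Let off_sum j x (u : nat -> R) :
  (forall m, u m = x * (lam ^+ (2 * m))^-1 * cell_coef a1 a2 b1 b2 m j *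
     ((2 * m).+1`!%:R^-1 * wright_V nu (- (2 * m)%:R) z)) ->
  sums_from `|j|%N u (- (x * lam) * odd_moment_sum j).
Proof.
move=> uE; apply: sums_from_odd => m.
rewrite uE wright_V_odd.
move: (lamX (2 * m)) ((2 * m).+1`!%:R^-1) => + y2.
by move: (lam ^+ (2 * m)) => L Ln; field.
Qed.

Lemma even_even_neq r s : a1 + a2 != b1 + b2 ->
  exists A,
    sums_from `|(s - r)%R|%N (fun m =>
      c ^+ (2 * m) * (a1 * b1 / (a2 * b2)) ^ (s - r) * theta_coef a1 a2 b1 b2 r s m *
      ((2 * m)`!%:R^-1 * wright_V nu (1 - (2 * m)%:R) z
       - c * ((2 * m).+1`!%:R^-1 * wright_V nu (- (2 * m)%:R) z))) A /\
    E (2 * r) (2 * s) = expR (mu `^ nu * t) * A.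
Proof.
move=> ab; exists (tempered_mean (2 * r) (2 * s)); split=> //.
apply: (@diag_sum _ _ _ c) => [||m]; first by ring.
  by rewrite up_even down_even cE /sg; field; rewrite gt_eqF.
by rewrite theta_term.
Qed.

Lemma odd_odd_neq r s : a1 + a2 != b1 + b2 ->
  exists A,
    sums_from `|(s - r)%R|%N (fun m =>
      (- c) ^+ (2 * m) * (a1 * b1 / (a2 * b2)) ^ (s - r) * theta_coef b1 b2 a1 a2 r s m *
      ((2 * m)`!%:R^-1 * wright_V nu (1 - (2 * m)%:R) z
       - (- c) * ((2 * m).+1`!%:R^-1 * wright_V nu (- (2 * m)%:R) z))) A /\
    E (2 * r + 1) (2 * s + 1) = expR (mu `^ nu * t) * A.
Proof.
move=> ab; exists (tempered_mean (2 * r + 1) (2 * s + 1)); split=> //.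
apply: (@diag_sum _ _ _ (- c)) => [||m]; first by ring.
  by rewrite up_odd down_odd cE /sg; field; rewrite gt_eqF.
by rewrite theta_term_swap.
Qed.

Let Esplit k n j : n = k + 2 * j + 1 ->
  E k n = expR (mu `^ nu * t) * (up k * odd_moment_sum j + down k * odd_moment_sum (j + 1)).
Proof. by move=> nk; rewrite /E (tempered_mean_odd nk). Qed.

Let lam2 : a1 + a2 + b1 + b2 + 2 * mu = 2 * lam. Proof. by rewrite /lam /sg; field. Qed.

Lemma even_odd_neq r s : a1 + a2 != b1 + b2 ->
  exists A B,
    [/\ sums_from `|(s - r)%R|%N (fun m =>
          c ^+ (2 * m) * (a1 * b1 / (a2 * b2)) ^ (s - r) * theta_coef a1 a2 b1 b2 r s m *
          ((2 * m).+1`!%:R^-1 * wright_V nu (- (2 * m)%:R) z)) A,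
        sums_from `|(s - r + 1)%R|%N (fun m =>
          c ^+ (2 * m) * (a1 * b1 / (a2 * b2)) ^ (s - r + 1) *
          theta_coef a1 a2 b1 b2 r (s + 1) m *
          ((2 * m).+1`!%:R^-1 * wright_V nu (- (2 * m)%:R) z)) B &
        E (2 * r) (2 * s + 1) =
          2 * expR (mu `^ nu * t) / (a1 + a2 + b1 + b2 + 2 * mu) * (- a1 * A - a2 * B)].
Proof.
move=> ab; exists (- (1 * lam) * odd_moment_sum (s - r)), (- (1 * lam) * odd_moment_sum (s - r + 1)).
split.
- by apply: off_sum => m; rewrite theta_term// mul1r.
- by apply: off_sum => m; rewrite theta_term ?mul1r//; ring.
- rewrite (@Esplit _ _ (s - r)); last by ring.
  by rewrite up_even down_even lam2; field.
Qed.

Lemma odd_even_neq r s : a1 + a2 != b1 + b2 ->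
  exists A B,
    [/\ sums_from `|(s - r)%R|%N (fun m =>
          (- c) ^+ (2 * m) * (a1 * b1 / (a2 * b2)) ^ (s - r) * theta_coef b1 b2 a1 a2 r s m *
          ((2 * m).+1`!%:R^-1 * wright_V nu (- (2 * m)%:R) z)) A,
        sums_from `|(s - r - 1)%R|%N (fun m =>
          (- c) ^+ (2 * m) * (a1 * b1 / (a2 * b2)) ^ (s - r - 1) *
          theta_coef b1 b2 a1 a2 r (s - 1) m *
          ((2 * m).+1`!%:R^-1 * wright_V nu (- (2 * m)%:R) z)) B &
        E (2 * r + 1) (2 * s) =
          2 * expR (mu `^ nu * t) / (a1 + a2 + b1 + b2 + 2 * mu) * (- b2 * A - b1 * B)].
Proof.
move=> ab; exists (- (1 * lam) * odd_moment_sum (s - r)), (- (1 * lam) * odd_moment_sum (s - r - 1)).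
split.
- by apply: off_sum => m; rewrite theta_term_swap// mul1r.
- by apply: off_sum => m; rewrite theta_term_swap ?mul1r//; ring.
(* As [2s = (2r + 1) + 2 (s - r - 1) + 1], the jump to the right at rate [b1] pairs with
   [s - r - 1], the jump to the left at rate [b2] with [s - r]. *)
- rewrite (@Esplit _ _ (s - r - 1)); last by ring.
  by rewrite up_odd down_odd lam2 subrK; field.
Qed.

Hypothesis ab : a1 + a2 = b1 + b2.

Let q := (a1 + a2 + mu)^-1.
Let w := - t * (a1 + a2 + mu) `^ nu.

Let lamq : a1 + a2 + mu = lam.
Proof.
rewrite /lam /sg (_ : a1 + a2 + b1 + b2 = 2 * (a1 + a2)); first by field.
by rewrite -addrA -ab; ring.
Qed.

Let wz : w = z. Proof. by rewrite /w /z lamq. Qed.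
Let qE : q = lam^-1. Proof. by rewrite /q lamq. Qed.

Lemma even_even_eq r s :
  exists A,
    sums_from `|(s - r)%R|%N (fun m =>
      q ^+ (2 * m) * (a1 * b1 / (a2 * b2)) ^ (s - r) * eta_coef a1 a2 b1 b2 r s m *
      ((2 * m)`!%:R^-1 * wright_V nu (1 - (2 * m)%:R) w)) A /\
    E (2 * r) (2 * s) = expR (mu `^ nu * t) * A.
Proof.
exists (tempered_mean (2 * r) (2 * s)); split=> //.
(* With equal total rates the diagonal of the shifted generator is zero, so the odd moments drop
   out. *)
apply: (@diag_sum _ _ _ 0) => [||m]; first by ring.
  by rewrite up_even down_even mul0r /sg -addrA -ab; field.
by rewrite -[q ^+ _ * _ * _]mulrA eta_term// wz qE exprVn mul0r subr0.
Qed.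

Lemma odd_odd_eq r s :
  exists A,
    sums_from `|(s - r)%R|%N (fun m =>
      q ^+ (2 * m) * (a1 * b1 / (a2 * b2)) ^ (s - r) * eta_coef b1 b2 a1 a2 r s m *
      ((2 * m)`!%:R^-1 * wright_V nu (1 - (2 * m)%:R) w)) A /\
    E (2 * r + 1) (2 * s + 1) = expR (mu `^ nu * t) * A.
Proof.
exists (tempered_mean (2 * r + 1) (2 * s + 1)); split=> //.
apply: (@diag_sum _ _ _ 0) => [||m]; first by ring.
  by rewrite up_odd down_odd mul0r /sg -addrA -ab; field.
by rewrite -[q ^+ _ * _ * _]mulrA eta_term_swap// wz qE exprVn mul0r subr0.
Qed.

Lemma even_odd_eq r s :
  exists A B,
    [/\ sums_from `|(s - r)%R|%N (fun m =>
          q ^+ (2 * m).+1 * (a1 * b1 / (a2 * b2)) ^ (s - r) * eta_coef a1 a2 b1 b2 r s m *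
          ((2 * m).+1`!%:R^-1 * wright_V nu (- (2 * m)%:R) w)) A,
        sums_from `|(s - r + 1)%R|%N (fun m =>
          q ^+ (2 * m).+1 * (a1 * b1 / (a2 * b2)) ^ (s - r + 1) *
          eta_coef a1 a2 b1 b2 r (s + 1) m *
          ((2 * m).+1`!%:R^-1 * wright_V nu (- (2 * m)%:R) w)) B &
        E (2 * r) (2 * s + 1) = expR (mu `^ nu * t) * (- a1 * A - a2 * B)].
Proof.
(* The odd exponent [2m + 1] of q supplies the extra [lam^-1]. *)
exists (- (lam^-1 * lam) * odd_moment_sum (s - r)), (- (lam^-1 * lam) * odd_moment_sum (s - r + 1)).
split.
- apply: off_sum => m; rewrite -[q ^+ _ * _ * _]mulrA eta_term; [|by []|by []].
  by rewrite wz qE exprS exprVn.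
- apply: off_sum => m; rewrite -[q ^+ _ * _ * _]mulrA eta_term; [|by []|by ring].
  by rewrite wz qE exprS exprVn.
- rewrite (@Esplit _ _ (s - r)); last by ring.
  by rewrite up_even down_even mulVf//; ring.
Qed.

Lemma odd_even_eq r s :
  exists A B,
    [/\ sums_from `|(s - r)%R|%N (fun m =>
          q ^+ (2 * m).+1 * (a1 * b1 / (a2 * b2)) ^ (s - r) * eta_coef b1 b2 a1 a2 r s m *
          ((2 * m).+1`!%:R^-1 * wright_V nu (- (2 * m)%:R) w)) A,
        sums_from `|(s - r - 1)%R|%N (fun m =>
          q ^+ (2 * m).+1 * (a1 * b1 / (a2 * b2)) ^ (s - r - 1) *
          eta_coef b1 b2 a1 a2 r (s - 1) m *
          ((2 * m).+1`!%:R^-1 * wright_V nu (- (2 * m)%:R) w)) B &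
        E (2 * r + 1) (2 * s) = expR (mu `^ nu * t) * (- b2 * A - b1 * B)].
Proof.
exists (- (lam^-1 * lam) * odd_moment_sum (s - r)), (- (lam^-1 * lam) * odd_moment_sum (s - r - 1)).
split.
- apply: off_sum => m; rewrite -[q ^+ _ * _ * _]mulrA eta_term_swap; [|by []|by []].
  by rewrite wz qE exprS exprVn.
- apply: off_sum => m; rewrite -[q ^+ _ * _ * _]mulrA eta_term_swap; [|by []|by ring].
  by rewrite wz qE exprS exprVn.
- rewrite (@Esplit _ _ (s - r - 1)); last by ring.
  by rewrite up_odd down_odd subrK mulVf//; ring.
Qed.

End TransitionProbabilities.

Theorem propositionA3 (R : realType) (a1 a2 b1 b2 nu mu : R)
  (ha1 : 0 < a1) (ha2 : 0 < a2) (hb1 : 0 < b1) (hb2 : 0 < b2)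
  (hnu0 : 0 < nu) (hnu1 : nu < 1) (hmu : 0 <= mu)
  (d0 : measure_display) (T0 : measurableType d0) (P0 : probability T0 R)
  (S0 : R -> T0 -> R) (f : R -> R -> R)
  (hS0 : stable_subordinator P0 nu S0)
  (hf : forall t : R, 0 < t -> has_density P0 (S0 t) (f t))
  (d : measure_display) (T : measurableType d) (P : probability T R)
  (p : R -> int -> int -> R) (X : R -> T -> int) (S : R -> T -> R)
  (hX : markov_chain P p X)
  (hgen : has_generator p (chain_gen a1 a2 b1 b2))
  (hS : tempered_stable_subordinator P nu mu f S)
  (hXS : independent_processes P X S) :
  let Y := time_change X S in
  let pt (k n : int) (t : R) :=
    cond_prob P (Y t @^-1` [set n]) (Y 0 @^-1` [set k]) in
  let sigma := a1 + a2 + b1 + b2 in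
  let delta := b1 + b2 - a1 - a2 in
  let rho := a1 * b1 / (a2 * b2) in
  (* (i) *)
  (a1 + a2 != b1 + b2 ->
   forall (s r : int) (t : R), 0 <= t ->
   let z := - t * (sigma / 2 + mu) `^ nu in
   let c := delta / (sigma + 2 * mu) in
   (P (Y 0 @^-1` [set 2 * r]) != 0%E ->
     (exists A,
       sums_from `|(s - r)%R|%N (fun n =>
         c ^+ (2 * n) * rho ^ (s - r) * theta_coef a1 a2 b1 b2 r s n *
         ((2 * n)`!%:R^-1 * wright_V nu (1 - (2 * n)%:R) z
          - c * ((2 * n).+1`!%:R^-1 * wright_V nu (- (2 * n)%:R) z))) A /\
       pt (2 * r) (2 * s) t = expR (mu `^ nu * t) * A)
     /\
     (exists A B,
       [/\ sums_from `|(s - r)%R|%N (fun n =>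
             c ^+ (2 * n) * rho ^ (s - r) * theta_coef a1 a2 b1 b2 r s n *
             ((2 * n).+1`!%:R^-1 * wright_V nu (- (2 * n)%:R) z)) A,
           sums_from `|(s - r + 1)%R|%N (fun n =>
             c ^+ (2 * n) * rho ^ (s - r + 1) *
             theta_coef a1 a2 b1 b2 r (s + 1) n *
             ((2 * n).+1`!%:R^-1 * wright_V nu (- (2 * n)%:R) z)) B &
           pt (2 * r) (2 * s + 1) t =
             2 * expR (mu `^ nu * t) / (sigma + 2 * mu)
             * (- a1 * A - a2 * B)]))
   /\
   (P (Y 0 @^-1` [set 2 * r + 1]) != 0%E ->
     (exists A B,
       [/\ sums_from `|(s - r)%R|%N (fun n =>
             (- c) ^+ (2 * n) * rho ^ (s - r) * theta_coef b1 b2 a1 a2 r s n *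
             ((2 * n).+1`!%:R^-1 * wright_V nu (- (2 * n)%:R) z)) A,
           sums_from `|(s - r - 1)%R|%N (fun n =>
             (- c) ^+ (2 * n) * rho ^ (s - r - 1) *
             theta_coef b1 b2 a1 a2 r (s - 1) n *
             ((2 * n).+1`!%:R^-1 * wright_V nu (- (2 * n)%:R) z)) B &
           pt (2 * r + 1) (2 * s) t =
             2 * expR (mu `^ nu * t) / (sigma + 2 * mu)
             * (- b2 * A - b1 * B)])
     /\
     (exists A,
       sums_from `|(s - r)%R|%N (fun n =>
         (- c) ^+ (2 * n) * rho ^ (s - r) * theta_coef b1 b2 a1 a2 r s n *
         ((2 * n)`!%:R^-1 * wright_V nu (1 - (2 * n)%:R) z
          - (- c) * ((2 * n).+1`!%:R^-1 * wright_V nu (- (2 * n)%:R) z))) A /\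
       pt (2 * r + 1) (2 * s + 1) t = expR (mu `^ nu * t) * A)))
  /\
  (* (ii) *)
  (a1 + a2 = b1 + b2 ->
   forall (s r : int) (t : R), 0 <= t ->
   let w := - t * (a1 + a2 + mu) `^ nu in
   let q := (a1 + a2 + mu)^-1 in
   (P (Y 0 @^-1` [set 2 * r]) != 0%E ->
     (exists A,
       sums_from `|(s - r)%R|%N (fun n =>
         q ^+ (2 * n) * rho ^ (s - r) * eta_coef a1 a2 b1 b2 r s n *
         ((2 * n)`!%:R^-1 * wright_V nu (1 - (2 * n)%:R) w)) A /\
       pt (2 * r) (2 * s) t = expR (mu `^ nu * t) * A)
     /\
     (exists A B,
       [/\ sums_from `|(s - r)%R|%N (fun n =>
             q ^+ (2 * n).+1 * rho ^ (s - r) * eta_coef a1 a2 b1 b2 r s n *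
             ((2 * n).+1`!%:R^-1 * wright_V nu (- (2 * n)%:R) w)) A,
           sums_from `|(s - r + 1)%R|%N (fun n =>
             q ^+ (2 * n).+1 * rho ^ (s - r + 1) *
             eta_coef a1 a2 b1 b2 r (s + 1) n *
             ((2 * n).+1`!%:R^-1 * wright_V nu (- (2 * n)%:R) w)) B &
           pt (2 * r) (2 * s + 1) t =
             expR (mu `^ nu * t) * (- a1 * A - a2 * B)]))
   /\
   (P (Y 0 @^-1` [set 2 * r + 1]) != 0%E ->
     (exists A B,
       [/\ sums_from `|(s - r)%R|%N (fun n =>
             q ^+ (2 * n).+1 * rho ^ (s - r) * eta_coef b1 b2 a1 a2 r s n *
             ((2 * n).+1`!%:R^-1 * wright_V nu (- (2 * n)%:R) w)) A,
           sums_from `|(s - r - 1)%R|%N (fun n =>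
             q ^+ (2 * n).+1 * rho ^ (s - r - 1) *
             eta_coef b1 b2 a1 a2 r (s - 1) n *
             ((2 * n).+1`!%:R^-1 * wright_V nu (- (2 * n)%:R) w)) B &
           pt (2 * r + 1) (2 * s) t =
             expR (mu `^ nu * t) * (- b2 * A - b1 * B)])
     /\
     (exists A,
       sums_from `|(s - r)%R|%N (fun n =>
         q ^+ (2 * n) * rho ^ (s - r) * eta_coef b1 b2 a1 a2 r s n *
         ((2 * n)`!%:R^-1 * wright_V nu (1 - (2 * n)%:R) w)) A /\
       pt (2 * r + 1) (2 * s + 1) t = expR (mu `^ nu * t) * A))).
Proof.
move=> Y pt sigma delta rho; split=> [ab|ab] s r t t0.
- move=> z c; split=> Pk; rewrite /pt.
  + split.
      have [A [hA EA]] := even_even_neq ha1 ha2 hb1 hb2 hnu0 hmu hS0 hX hgen t0 r s ab.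
      by exists A; split=> //; rewrite (cond_prob_time_change hmu hS0 hf hX hgen hS hXS t0 _ Pk).
    have [A [B [hA hB EA]]] := even_odd_neq ha1 ha2 hb1 hb2 hnu0 hmu hS0 hX hgen t0 r s ab.
    by exists A, B; split=> //; rewrite (cond_prob_time_change hmu hS0 hf hX hgen hS hXS t0 _ Pk).
  + split.
      have [A [B [hA hB EA]]] := odd_even_neq ha1 ha2 hb1 hb2 hnu0 hmu hS0 hX hgen t0 r s ab.
      by exists A, B; split=> //; rewrite (cond_prob_time_change hmu hS0 hf hX hgen hS hXS t0 _ Pk).
    have [A [hA EA]] := odd_odd_neq ha1 ha2 hb1 hb2 hnu0 hmu hS0 hX hgen t0 r s ab.
    by exists A; split=> //; rewrite (cond_prob_time_change hmu hS0 hf hX hgen hS hXS t0 _ Pk).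
- move=> w q; split=> Pk; rewrite /pt.
  + split.
      have [A [hA EA]] := even_even_eq ha1 ha2 hb1 hb2 hnu0 hmu hS0 hX hgen t0 ab r s.
      by exists A; split=> //; rewrite (cond_prob_time_change hmu hS0 hf hX hgen hS hXS t0 _ Pk).
    have [A [B [hA hB EA]]] := even_odd_eq ha1 ha2 hb1 hb2 hnu0 hmu hS0 hX hgen t0 ab r s.
    by exists A, B; split=> //; rewrite (cond_prob_time_change hmu hS0 hf hX hgen hS hXS t0 _ Pk).
  + split.
      have [A [B [hA hB EA]]] := odd_even_eq ha1 ha2 hb1 hb2 hnu0 hmu hS0 hX hgen t0 ab r s.
      by exists A, B; split=> //; rewrite (cond_prob_time_change hmu hS0 hf hX hgen hS hXS t0 _ Pk).
    have [A [hA EA]] := odd_odd_eq ha1 ha2 hb1 hb2 hnu0 hmu hS0 hX hgen t0 ab r s.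
    by exists A; split=> //; rewrite (cond_prob_time_change hmu hS0 hf hX hgen hS hXS t0 _ Pk).
Qed.
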